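(* Let $i\in\{-1,0,1\}$. The divisor $D=dH-\sum_{j=1}^s m_jE_j$ is a divisorial $(i)$ class on $X_{n,s}$ if and only if $D$ is effective, satisfies the numerical conditions $$(n-1)d^2-\sum_{j=1}^s m_j^2=i,\qquad (n+1)d-\sum_{j=1}^s m_j=2+i,$$ and for all degrees $0<d'<d$ and all divisorial $(-1)$ classes $D'$ of degree $d'$ one has $\langle D,D'\rangle\ge 0$.
   Context: Let $n\ge 2$. $X_{n,s}$ denotes the blow up of $\mathbb{P}^n$ in a collection of $s$ points $p_1,\dots,p_s$ in general position. $\operatorname{Pic}(X_{n,s})$ is generated by $H,E_1,\dots,E_s$, where $H$ is a general hyperplane class and $E_j$ is the exceptional divisor corresponding to $p_j$. The degree of $D=dH-\sum_j m_jE_j$ is the coefficient $d$. The Dolgachev-Mukai pairing on $\operatorname{Pic}(X_{n,s})$ is the symmetric bilinear form with $\langle H,H\rangle=n-1$, $\langle H,E_j\rangle=0$, $\langle E_j,E_k\rangle=-\delta_{j,k}$. The canonical divisor is $K_{X_{n,s}}=-(n+1)H+(n-1)\sum_j E_j$. For $D=dH-\sum_j m_jE_j$ one has $\langle D,D\rangle=(n-1)d^2-\sum_j m_j^2$, and one puts $\operatorname{adeg}(D)=\frac{1}{n-1}\langle D,-K_{X_{n,s}}\rangle=(n+1)d-\sum_j m_j$. For $i\in\{-1,0,1\}$, a divisorial $(i)$ class on $X_{n,s}$ is an effective and irreducible divisor $D$ (possibly non-reduced) satisfying $\langle D,D\rangle=i$ and $\operatorname{adeg}(D)=2+i$; these are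 the two numerical conditions displayed in the claim.
   Formalization: Assumes m_j ≥ 0 for all j when d > 0; without it the claim fails, e.g. n=2, s=10, i=-1, D=3H+E_1-E_2-...-E_10. ''General position'' means a nonempty open set of point tuples that may depend on D. *)

(* Defs.v *)
From HB Require Import structures.
From mathcomp Require Import all_boot all_order all_algebra.
From mathcomp Require Export mpoly.

Set Implicit Arguments.
Unset Strict Implicit.
Unset Printing Implicit Defensive.

Import Order.TTheory GRing.Theory Num.Theory.
Local Open Scope ring_scope.

(** ** The lattice Pic(X_{n,s})

    The pair (d, m) stands for the class d H - sum_j m_j E_j; this is the free
    abelian group on H, E_1, .., E_s with the sign of the last s coordinates
    changed (see [dclassE]), so its addition is the componentwise one. *)

Definition Pic (s : nat) : zmodType := (int * {ffun 'I_s -> int})%type.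

Definition dclass (s : nat) (d : int) (m : 'I_s -> int) : Pic s :=
  (d, [ffun j => m j]).

Definition deg (s : nat) (D : Pic s) : int := D.1.
Definition mlt (s : nat) (D : Pic s) (j : 'I_s) : int := D.2 j.

Definition Hcl (s : nat) : Pic s := dclass 1 (fun=> 0).
Definition Ecl (s : nat) (j : 'I_s) : Pic s :=
  dclass 0 (fun k => - (k == j)%:R).

(* The Dolgachev-Mukai pairing; see [pairing_HH], [pairing_HE], [pairing_EE]. *)
Definition pairing (n s : nat) (D D' : Pic s) : int :=
  (n%:Z - 1) * deg D * deg D' - \sum_(j < s) mlt D j * mlt D' j.

(* K = -(n+1) H + (n-1) sum_j E_j *)
Definition canonical_class (n s : nat) : Pic s :=
  dclass (- (n%:Z + 1)) (fun=> - (n%:Z - 1)).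

(* Written without the division by n - 1; see [adegE]. *)
Definition adeg (n s : nat) (D : Pic s) : int :=
  (n%:Z + 1) * deg D - \sum_(j < s) mlt D j.

(** ** Divisors on X_{n,s}

    The rows of p : 'M_(s, n.+1) are homogeneous coordinates of the points
    p_1, .., p_s of P^n. *)

(* Multiplicity at [v] of the hypersurface G = 0: the least degree of a monomial
   of G(v + X).  As G is homogeneous, the order of vanishing at the vector v in
   affine (n+1)-space is the order of vanishing at the point [v] of P^n. *)
Definition mult (K : fieldType) (n : nat) (v : 'rV[K]_n.+1)
    (G : {mpoly K[n.+1]}) : nat :=
  let T := G \mPo [tuple 'X_k + (v 0 k)%:MP | k < n.+1] in
  \big[minn/msize T]_(mon <- msupp T) mdeg mon.

Definition irreducible_elt (R : idomainType) (x : R) : Prop :=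
  [/\ x != 0, x \isn't a GRing.unit &
      forall a b : R, x = a * b -> (a \is a GRing.unit) || (b \is a GRing.unit)].

(* The prime divisors of the blow-up: the exceptional divisors, and the strict
   transforms of the irreducible hypersurfaces G = 0 of P^n. *)
Inductive prime_divisor (K : fieldType) (n s : nat) : Type :=
| Exceptional of 'I_s
| StrictTransform (e : nat) (G : {mpoly K[n.+1]}) of
    G \is e.-homog & irreducible_elt G.

Definition prime_class (K : fieldType) (n s : nat) (p : 'M[K]_(s, n.+1))
    (P : prime_divisor K n s) : Pic s :=
  match P with
  | Exceptional j => Ecl j
  | StrictTransform e G _ _ =>
      dclass e%:Z (fun j => (mult (row j p) G)%:Z)
  end.

(* An effective divisor is a finite sum of prime divisors, with repetitions. *)
Definition effective_divisor (K : fieldType) (n s : nat) : Type :=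
  seq (prime_divisor K n s).

Definition divisor_class (K : fieldType) (n s : nat) (p : 'M[K]_(s, n.+1))
    (A : effective_divisor K n s) : Pic s :=
  \sum_(P <- A) prime_class p P.

(* Irreducible, possibly non-reduced: a positive multiple of a prime divisor. *)
Definition irreducible_divisor (K : fieldType) (n s : nat)
    (A : effective_divisor K n s) : Prop :=
  exists (k : nat) (P : prime_divisor K n s), A = nseq k.+1 P.

Definition effective (K : fieldType) (n s : nat) (p : 'M[K]_(s, n.+1))
    (D : Pic s) : Prop :=
  exists A : effective_divisor K n s, divisor_class p A = D.

Definition effective_irreducible (K : fieldType) (n s : nat)
    (p : 'M[K]_(s, n.+1)) (D : Pic s) : Prop :=
  exists2 A : effective_divisor K n s,
    divisor_class p A = D & irreducible_divisor A.

Definition divisorial_class (K : fieldType) (n s : nat) (p : 'M[K]_(s, n.+1))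
    (i : int) (D : Pic s) : Prop :=
  [/\ effective_irreducible p D, pairing n D D = i & adeg n D = 2 + i].

(** ** General position

    A property holds for s points of P^n in general position when it holds on
    a dense Zariski-open subset of (P^n)^s, here the set of tuples at which a
    nonzero polynomial F in all the coordinates does not vanish.  F need not be
    multihomogeneous: the tuples of nonzero vectors with F <> 0 still have a
    nonempty open image in (P^n)^s. *)
Definition for_general_points (K : fieldType) (n s : nat)
    (Q : 'M[K]_(s, n.+1) -> Prop) : Prop :=
  exists2 F : {mpoly K[s * n.+1]}, F != 0 &
    forall p : 'M[K]_(s, n.+1),
      (forall j, row j p != 0) -> F.@[fun k => mxvec p 0 k] != 0 -> Q p.

(** ** Consistency of the numerical conventions *)

Lemma dclassE (s : nat) (d : int) (m : 'I_s -> int) :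
  dclass d m = Hcl s *~ d - \sum_(j < s) Ecl j *~ m j.
Proof.
have fstz (x : Pic s) z : (x *~ z).1 = x.1 *~ z.
  exact: (raddfMz (fst : {additive Pic s -> int})).
have sndz (x : Pic s) z k : (x *~ z).2 k = x.2 k *~ z.
  have -> : (x *~ z).2 = x.2 *~ z.
    exact: (raddfMz (snd : {additive Pic s -> {ffun 'I_s -> int}})).
  by case: z => t; rewrite ?NegzE ?mulrNz ?ffunE -?pmulrn ffunMnE.
have e1 : (\sum_(j < s) Ecl j *~ m j).1 = 0.
  rewrite (raddf_sum (fst : {additive Pic s -> int})) big1 // => j _.
  by rewrite /= fstz /= mul0rz.
have e2 k : (\sum_(j < s) Ecl j *~ m j).2 k = - m k.
  rewrite (raddf_sum (snd : {additive Pic s -> {ffun 'I_s -> int}})) sum_ffunE.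
  rewrite (bigD1 k) //= sndz ffunE eqxx big1 ?addr0.
    by rewrite mulNrz intz.
  by move=> j jk; rewrite sndz ffunE eq_sym (negbTE jk) oppr0 mul0rz.
rewrite /dclass; apply/eqP; rewrite xpair_eqE /=; apply/andP; split.
  by rewrite e1 fstz subr0 /= intz.
by apply/eqP/ffunP => k; rewrite !ffunE e2 sndz ffunE mul0rz add0r opprK.
Qed.

Lemma pairing_HH (n s : nat) : pairing n (Hcl s) (Hcl s) = n%:Z - 1.
Proof.
rewrite /pairing big1 ?subr0 ?mulr1 // => j _.
by rewrite /mlt /= ffunE mul0r.
Qed.

Lemma pairing_HE (n s : nat) (j : 'I_s) : pairing n (Hcl s) (Ecl j) = 0.
Proof.
rewrite /pairing big1 ?subr0 ?mulr0 // => k _.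
by rewrite /mlt /= !ffunE mul0r.
Qed.

Lemma pairing_EE (n s : nat) (j k : 'I_s) :
  pairing n (Ecl j) (Ecl k) = - (j == k)%:R.
Proof.
rewrite /pairing /= !mulr0 sub0r (bigD1 j) //= big1 ?addr0.
  by rewrite /mlt /= !ffunE eqxx mulrNN mul1r.
by move=> l lj; rewrite /mlt /= !ffunE (negbTE lj) oppr0 mul0r.
Qed.

Lemma adegE (n s : nat) (D : Pic s) :
  (n%:Z - 1) * adeg n D = pairing n D (- canonical_class n s).
Proof.
rewrite /adeg /pairing /= opprK mulrBr mulr_sumr; congr (_ - _).
  by rewrite mulrA mulrAC.
by apply: eq_bigr => j _; rewrite /mlt /= !ffunE opprK mulrC.
Qed.

(* Main.v *)
From HB Require Import structures.
Require Import Defs.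
From mathcomp Require Import all_boot all_order all_algebra.
From mathcomp Require Import zify ring.

Set Implicit Arguments.
Unset Strict Implicit.
Unset Printing Implicit Defensive.

Import Order.TTheory GRing.Theory Num.Theory.
Local Open Scope ring_scope.

(** The proof follows Nagata: divisors are moved by Cremona transformations of the
    blown-up space until their degree is at most 1.

    A Cremona transformation based at n+1 of the points of a general configuration
    p is an isomorphism in codimension one from the blow-up in p to the blow-up in
    another configuration q. It carries prime divisors to prime divisors and acts
    on classes by a reflection, which preserves the pairing and adeg
    ([maps_cremona]). In the coordinates of the base points it inverts the
    coordinates; hypersurfaces are transformed by inverting the variables of their
    equation ([invert_irreducible], [mult_invert]). As p varies, q is again
    general ([general_cremona]), so properties of general points may be used after
    the transformation. Only finitely many transformations are needed for a given
    class, hence only finitely many open conditions on p.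

    Noether's inequality ([noether]) makes this useful: if a class satisfies the
    two numerical conditions and has multiplicities between 0 and its degree
    d >= 2, then some n+1 multiplicities have sum greater than (n-1)d, and the
    Cremona transformation based there lowers the degree. In degree 1 the class is
    a hyperplane through some n - 1 - i of the points, and in degree 0 it is an
    exceptional divisor.

    If D is a divisorial (i) class and D' a divisorial (-1) class of smaller
    degree, the reduction of D' ends with an exceptional divisor E_j. The
    transform of D is irreducible and is not a multiple of E_j, and its pairing
    with E_j is its j-th multiplicity, which is nonnegative
    ([negative_class_pairing]). The exception is the hyperplane through all the
    points when there are exactly n of them, which is compared with D directly
    ([hyperplane_pairing]).

    Conversely, reduce an effective D. If no negative multiplicity appears on the
    way, D ends as a hyperplane or an exceptional divisor and is irreducible.
    Otherwise an exceptional divisor has negative pairing with the transform of D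
    and is a component of it; pulled back, it is a (-1) class E such that D - E is
    effective and <D, E> < 0 ([irreducible_or_negative]). Then deg E <= d. The
    hypotheses exclude deg E < d, and if deg E = d the inequality <D, E> < 0
    forces D = E, which is irreducible. *)

(** * Substitution and order of vanishing *)

Notation subst h := (comp_mpoly (mktuple h)).

Section Substitution.
Variables (R : comNzRingType) (n k : nat).
Implicit Types (G : {mpoly R[n]}) (h : 'I_n -> {mpoly R[k]}).

Lemma substE h G :
  subst h G = \sum_(a <- msupp G) G@_a *: \prod_(i < n) h i ^+ a i.
Proof.
rewrite comp_mpolyE; apply: eq_bigr => a _; congr (_ *: _).
by apply: eq_bigr => i _; rewrite tnth_mktuple.
Qed.

Lemma substU h i : subst h 'X_i = h i.
Proof. by rewrite comp_mpolyXU -tnth_nth tnth_mktuple. Qed.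

Lemma eq_subst h h' : h =1 h' -> subst h =1 subst h'.
Proof. by move=> e G; rewrite !substE; under eq_bigr do under eq_bigr do rewrite e. Qed.

Lemma meval_subst h G (v : 'I_k -> R) :
  (subst h G).@[v] = G.@[fun i => (h i).@[v]].
Proof.
by rewrite comp_mpoly_meval; apply: meval_eq => i; rewrite tnth_mktuple.
Qed.
End Substitution.

Lemma subst_comp (R : comNzRingType) (n k l : nat) (h : 'I_n -> {mpoly R[k]})
    (g : 'I_k -> {mpoly R[l]}) (G : {mpoly R[n]}) :
  subst g (subst h G) = subst (fun i => subst g (h i)) G.
Proof.
rewrite !substE -substE raddf_sum; apply: eq_bigr => a _ /=.
rewrite comp_mpolyZ rmorph_prod; congr (_ *: _).
by apply: eq_bigr => i _; rewrite rmorphXn.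
Qed.

Lemma subst_id (R : comNzRingType) (n : nat) (G : {mpoly R[n]}) :
  subst (fun i => 'X_i) G = G.
Proof. exact: comp_mpoly_id. Qed.

Section Order.
Variables (K : fieldType).

Definition ord_ge n (m : nat) (P : {mpoly K[n]}) : Prop :=
  forall a, (mdeg a < m)%N -> P@_a = 0.

Section Basic.
Variable n : nat.
Implicit Types (P Q : {mpoly K[n]}) (m : nat).

Lemma ord_ge0 P : ord_ge 0 P. Proof. by []. Qed.

Lemma ord_ge_leq m m' P : (m <= m')%N -> ord_ge m' P -> ord_ge m P.
Proof. by move=> le H a am; apply: H; apply: leq_trans le. Qed.

Lemma ord_ge1P P : ord_ge 1 P <-> P@_0%MM = 0.
Proof.
split=> [H|H a]; first by apply: H; rewrite mdeg0.
by rewrite ltnS leqn0 mdeg_eq0 => /eqP ->.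
Qed.

Lemma ord_ge_sum m (I : Type) (r : seq I) (F : I -> {mpoly K[n]}) :
  (forall i, ord_ge m (F i)) -> ord_ge m (\sum_(i <- r) F i).
Proof. by move=> H a am; rewrite raddf_sum big1 // => i _; apply: H. Qed.

Lemma ord_geB m P Q : ord_ge m P -> ord_ge m Q -> ord_ge m (P - Q).
Proof. by move=> HP HQ a am; rewrite mcoeffB HP // HQ // subr0. Qed.

Lemma ord_geZ m c P : ord_ge m P -> ord_ge m (c *: P).
Proof. by move=> HP a am; rewrite mcoeffZ HP // mulr0. Qed.

Lemma ord_geM m m' P Q : ord_ge m P -> ord_ge m' Q -> ord_ge (m + m') (P * Q).
Proof.
move=> HP HQ a am; rewrite mcoeffM big1 // => -[b c] /= /eqP e.
case: (ltnP (mdeg b) m) => [/HP ->|bm]; first by rewrite mul0r.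
rewrite (HQ c) ?mulr0 // -(ltn_add2l (mdeg b)) -mdegD -e.
by rewrite (leq_trans am) // leq_add2r.
Qed.

Lemma ord_geX m P k : ord_ge m P -> ord_ge (m * k) (P ^+ k).
Proof.
move=> HP; elim: k => [|k IH]; first by rewrite muln0.
by rewrite exprS mulnS; apply: ord_geM.
Qed.

Lemma ord_ge_prod (I : Type) (r : seq I) (e : I -> nat) (F : I -> {mpoly K[n]}) :
  (forall i, ord_ge (e i) (F i)) -> ord_ge (\sum_(i <- r) e i) (\prod_(i <- r) F i).
Proof.
move=> H; elim: r => [|i r IH]; first by rewrite big_nil.
by rewrite !big_cons; apply: ord_geM.
Qed.

(** A factor with nonzero constant term is invertible modulo every power of the
    ideal of the origin. *)
Lemma ord_ge_cancel m P Q : P@_0%MM != 0 -> ord_ge m (P * Q) -> ord_ge m Q.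
Proof.
move=> P0 H; have: forall k, (k <= m)%N -> ord_ge k Q; last by apply.
elim=> [|k IH] km //; have {}IH := IH (ltnW km).
have P1 : ord_ge 1 (P - (P@_0%MM)%:MP).
  by apply/ord_ge1P; rewrite mcoeffB mcoeffC eqxx mulr1 subrr.
have := ord_geB (ord_ge_leq km H) (ord_geM P1 IH).
rewrite -mulrBl opprB addrC subrK mul_mpolyC => /(ord_geZ (P@_0%MM)^-1).
by rewrite scalerA mulVf // scale1r.
Qed.
End Basic.

Lemma ord_ge_subst n k m (h : 'I_n -> {mpoly K[k]}) (P : {mpoly K[n]}) :
  (forall i, ord_ge 1 (h i)) -> ord_ge m P -> ord_ge m (subst h P).
Proof.
move=> Hh HP; rewrite substE.
apply: ord_ge_sum => a; case: (ltnP (mdeg a) m) => [/HP ->|am].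
  by rewrite scale0r => b _; rewrite mcoeff0.
apply: ord_geZ; apply: ord_ge_leq am _; rewrite mdegE.
by apply: ord_ge_prod => i; have := ord_geX (k := a i) (Hh i); rewrite mul1n.
Qed.

Lemma mcoeff0_meval n (P : {mpoly K[n]}) : P@_0%MM = P.@[fun=> 0].
Proof.
rewrite {1 2}[P]mpolyE !raddf_sum /=; apply: eq_bigr => a _.
rewrite mcoeffZ mevalZ mcoeffX mevalX; congr (_ * _).
case: eqP => [->|a0]; first by rewrite big1 // => i _; rewrite mnm0E.
have [/existsP[j aj]|] := boolP [exists j, a j != 0%N].
  by rewrite (bigD1 j) //= expr0n (negbTE aj) mul0r.
rewrite negb_exists => /forallP H; case: a0; apply/mnmP => j.
by rewrite mnm0E; apply/eqP; rewrite -[_ == _]negbK.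
Qed.

Definition translate n (v : 'rV[K]_n) (k : 'I_n) : {mpoly K[n]} :=
  'X_k + (v 0 k)%:MP.

Definition vanishes n (m : nat) (v : 'rV[K]_n) (G : {mpoly K[n]}) : Prop :=
  ord_ge m (subst (translate v) G).

Lemma subst_translateK n (v : 'rV[K]_n) G :
  subst (translate (- v)) (subst (translate v) G) = G.
Proof.
rewrite subst_comp -[RHS]subst_id; apply: eq_subst => i.
rewrite /translate rmorphD /= substU comp_mpolyC mxE mpolyCN.
by rewrite -addrA addNr addr0.
Qed.

(** The minimum defining [mult] has the default value msize, above all degrees that
    occur; only for G = 0 is it attained, and there the equivalence fails. *)
Lemma mult_geP n m (v : 'rV[K]_n.+1) (G : {mpoly K[n.+1]}) :
  G != 0 -> (m <= mult v G)%N <-> vanishes m v G.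
Proof.
move=> G0; rewrite /vanishes /mult -/(translate v).
have -> : [tuple 'X_k + (v 0 k)%:MP | k < n.+1] = mktuple (translate v) by [].
set T := subst (translate v) G.
have T0 : T != 0.
  by apply: contraNneq G0 => e; rewrite -(subst_translateK v G) -/T e raddf0.
split=> [H a am|H].
  apply: memN_msupp_eq0; apply: contraTN am => aT; rewrite -leqNgt.
  apply: leq_trans H _; elim: (msupp T) aT => // b r IH.
  rewrite big_cons inE => /predU1P[->|/IH]; first exact: geq_minl.
  by apply: leq_trans; apply: geq_minr.
rewrite big_seq; apply: (big_ind (fun x => (m <= x)%N)) => [|x y mx my|a].
- rewrite leqNgt; apply: contraNN T0 => lt; apply/eqP/mpolyP => a.
  rewrite mcoeff0; case: (ltnP (mdeg a) m) => [/H //|am].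
  by apply: memN_msupp_eq0; apply: msize_mdeg_ge; rewrite ltnW // (leq_trans lt).
- by rewrite leq_min mx.
- by move=> aT; rewrite leqNgt; apply: contraTN aT => /H; rewrite mcoeff_msupp => ->; rewrite eqxx.
Qed.

(** A polynomial map sending w to v pulls the ideal of v back into the ideal of w,
    hence also its powers. *)
Lemma vanishes_subst n k m (h : 'I_n -> {mpoly K[k]}) (v : 'rV[K]_n)
    (w : 'rV[K]_k) (G : {mpoly K[n]}) :
  (forall i, (h i).@[w 0] = v 0 i) -> vanishes m v G -> vanishes m w (subst h G).
Proof.
move=> Hh HG; rewrite /vanishes.
have -> : subst (translate w) (subst h G) =
   subst (fun i => subst (translate w) (h i) - (v 0 i)%:MP) (subst (translate v) G).
  rewrite !subst_comp; apply: eq_subst => i.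
  by rewrite /translate rmorphD /= substU comp_mpolyC subrK.
apply: ord_ge_subst HG => i; apply/ord_ge1P; rewrite mcoeffB mcoeffC eqxx mulr1.
rewrite mcoeff0_meval meval_subst -Hh; apply/eqP; rewrite subr_eq0; apply/eqP/meval_eq => j.
by rewrite /translate mevalD mevalXU mevalC add0r.
Qed.

End Order.

(** * Multiplicities and changes of coordinates *)

Section Mult.
Variables (K : fieldType) (n : nat).
Implicit Types (G F : {mpoly K[n]}) (v w : 'rV[K]_n) (A B : 'M[K]_n).

(** A polynomial that is nonzero at v is a unit in the local ring of v. *)
Lemma vanishes_cancel m v F G :
  F.@[v 0] != 0 -> vanishes m v (F * G) -> vanishes m v G.
Proof.
move=> Fv; rewrite /vanishes rmorphM /=; apply: ord_ge_cancel.
rewrite mcoeff0_meval meval_subst; congr (_ != 0): Fv; apply: meval_eq => i.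
by rewrite /translate mevalD mevalXU mevalC add0r.
Qed.

Lemma vanishes1P v G : vanishes 1 v G <-> G.@[v 0] = 0.
Proof.
rewrite /vanishes ord_ge1P mcoeff0_meval meval_subst.
have -> // : G.@[fun i => (translate v i).@[fun=> 0]] = G.@[v 0].
by apply: meval_eq => i; rewrite /translate mevalD mevalXU mevalC add0r.
Qed.

Lemma homog_mdeg e G a : G \is e.-homog -> a \in msupp G -> mdeg a = e.
Proof. by move=> /dhomogP He /He. Qed.

Lemma msize_subst k (h : 'I_n -> {mpoly K[k]}) G :
  (forall i, (msize (h i) <= 2)%N) -> (msize (subst h G) <= msize G)%N.
Proof.
move=> Hh; rewrite substE.
apply: leq_trans (msize_sum _ _ _) _; rewrite big_seq.
apply: (big_ind (fun x => (x <= msize G)%N)) => // [x y xG yG|a aG].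
  by rewrite geq_max xG.
apply: leq_trans (msizeZ_le _ _) _; apply: leq_trans _ (msize_mdeg_lt aG).
rewrite mdegE.
pose P (x : nat) (p : {mpoly K[k]}) := (msize p <= x.+1)%N.
apply: (big_ind2 P) => [|x p y q|i _].
- by rewrite /P msize1.
- rewrite /P => Hp Hq; have [->|p0] := eqVneq p 0; first by rewrite mul0r msize0.
  have [->|q0] := eqVneq q 0; first by rewrite mulr0 msize0.
  rewrite msizeM //; move: Hp Hq; move: (msize p) (msize q) => u w; lia.
- rewrite /P; elim: (a i) => [|l IH]; first by rewrite expr0 msize1.
  rewrite exprS; have [->|p0] := eqVneq (h i) 0; first by rewrite mul0r msize0.
  have [e|q0] := eqVneq (h i ^+ l) 0; first by rewrite e mulr0 msize0.
  rewrite msizeM //; have := Hh i; move: IH; move: (msize _) (msize _) => u w; lia.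
Qed.

Definition linform A (i : 'I_n) : {mpoly K[n]} := \sum_l A l i *: 'X_l.

Lemma meval_linform A (v : 'I_n -> K) i : (linform A i).@[v] = \sum_l v l * A l i.
Proof.
rewrite /linform raddf_sum; apply: eq_bigr => l _ /=.
by rewrite mevalZ mevalXU mulrC.
Qed.

Lemma linform_homog A i : linform A i \is 1.-homog.
Proof.
by apply: rpred_sum => l _; apply: rpredZ; rewrite dhomogX /= mdeg1.
Qed.

Lemma subst_linform A B G :
  subst (linform A) (subst (linform B) G) = subst (linform (A *m B)) G.
Proof.
rewrite subst_comp; apply: eq_subst => i; rewrite {1}/linform raddf_sum /=.
rewrite (eq_bigr (fun l => \sum_k (A k l * B l i) *: 'X_k)); last first.
  move=> l _; rewrite linearZ /= substU /linform scaler_sumr.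
  by apply: eq_bigr => k _; rewrite scalerA mulrC.
rewrite exchange_big; apply: eq_bigr => k _ /=.
by rewrite -scaler_suml mxE.
Qed.

Lemma subst_linform1 G : subst (linform 1%:M) G = G.
Proof.
rewrite -[RHS]subst_id; apply: eq_subst => i.
rewrite /linform (bigD1 i) //= mxE eqxx scale1r big1 ?addr0 // => l li.
by rewrite mxE (negbTE li) scale0r.
Qed.

Lemma vanishes_linform A m v G :
  vanishes m (v *m A) G -> vanishes m v (subst (linform A) G).
Proof. by apply: vanishes_subst => i; rewrite meval_linform mxE. Qed.

Lemma homog_subst_linear e (h : 'I_n -> {mpoly K[n]}) G :
  (forall i, h i \is 1.-homog) -> G \is e.-homog -> subst h G \is e.-homog.
Proof.
move=> Hh HG; rewrite substE big_seq; apply: rpred_sum => a aG.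
apply: rpredZ; rewrite -(homog_mdeg HG aG) mdegE.
pose P (x : nat) (p : {mpoly K[n]}) := p \is x.-homog.
apply: (big_ind2 P) => [|x p y q|i _]; rewrite /P.
- exact: dhomog1.
- exact: dhomogM.
- by have := dhomogMn (a i) (Hh i); rewrite mul1n.
Qed.

Lemma unit_mpolyC (c : K) : c != 0 -> c%:MP_[n] \is a GRing.unit.
Proof. by move=> c0; apply/unitrP; exists (c^-1%:MP); rewrite -!mpolyCM mulVf ?mulfV. Qed.

Lemma unit_mpolyP G : G \is a GRing.unit -> exists2 c, c != 0 & G = c%:MP.
Proof.
move=> /andP[/eqP e]; rewrite unitfE => c0.
by exists (G@_0%MM).
Qed.

Lemma linear_irreducible G : G != 0 -> G \is 1.-homog -> irreducible_elt G.
Proof.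
move=> G0 G1; have sG : msize G = 2%N.
  have := mlead_deg G0; by rewrite (homog_mdeg G1 (mlead_supp G0)) => <-.
split=> //.
  by apply/negP => /unit_mpolyP[c c0 e]; move: sG; rewrite e msizeC c0.
have small (a : {mpoly K[n]}) : msize a = 1%N -> a \is a GRing.unit.
  by move/eqP/msize_poly1P => [c c0 ->]; apply: unit_mpolyC.
move=> a b e; have [a0 b0] : a != 0 /\ b != 0.
  by split; apply: contraNneq G0; rewrite e => ->; rewrite ?mul0r ?mulr0.
move: sG; rewrite e msizeM // => s2.
have := a0; have := b0; rewrite -!msize_poly_eq0 => sa sb.
have : msize a = 1%N \/ msize b = 1%N by lia.
by case=> /small ->; rewrite ?orbT.
Qed.
End Mult.

Lemma irreducible_iso (R S : idomainType) (f : {rmorphism R -> S})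
    (g : {rmorphism S -> R}) (fK : cancel f g) (gK : cancel g f) x :
  irreducible_elt x -> irreducible_elt (f x).
Proof.
move=> [x0 xU xI]; split.
- by apply: contraNneq x0 => e; rewrite -[x]fK e rmorph0.
- by apply: contraNN xU => /(rmorph_unit g); rewrite fK.
- move=> a b e; have := xI (g a) (g b); rewrite -rmorphM -e fK => /(_ erefl).
  by case/orP=> /(rmorph_unit f); rewrite gK => ->; rewrite ?orbT.
Qed.

Section ProjMult.
Variables (K : fieldType) (n : nat).
Implicit Types (G F : {mpoly K[n.+1]}) (v w : 'rV[K]_n.+1) (A B : 'M[K]_n.+1).

(** All monomials of G(v + X) have degree at most that of G. *)
Lemma mult_le_deg e v G : G != 0 -> G \is e.-homog -> (mult v G <= e)%N.
Proof.
move=> G0 He; have sG : msize G = e.+1.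
  by have := mlead_deg G0; rewrite (homog_mdeg He (mlead_supp G0)) => <-.
rewrite leqNgt; apply/negP => /(mult_geP _ _ G0) H.
have T0 : subst (translate v) G = 0.
  apply/mpolyP => a; rewrite mcoeff0; case: (ltnP (mdeg a) e.+1) => [/H //|ea].
  apply: memN_msupp_eq0; apply: msize_mdeg_ge.
  apply: leq_trans ea; rewrite -sG; apply: msize_subst => i.
  apply: leq_trans (msizeD_le _ _) _; rewrite msizeX mdeg1 geq_max /=.
  by rewrite msizeC; case: eqP.
by move: G0; rewrite -[G](subst_translateK v) T0 raddf0 eqxx.
Qed.

Lemma mult_linear v G : G != 0 -> G \is 1.-homog -> mult v G = (G.@[v 0] == 0).
Proof.
move=> G0 G1; have := mult_le_deg v G0 G1.
have := mult_geP 1 v G0; rewrite vanishes1P.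
case: eqP => [e [_ /(_ e)]|ne [H _]]; first by lia.
by case: (mult v G) H => // k H; case: ne; apply: H.
Qed.

Lemma eq_mult v w F G : F != 0 -> G != 0 ->
  (forall m, vanishes m v F <-> vanishes m w G) -> mult v F = mult w G.
Proof.
move=> F0 G0 H; apply/eqP; rewrite eqn_leq; apply/andP; split.
  by apply/(mult_geP _ _ G0)/H/(mult_geP _ _ F0).
by apply/(mult_geP _ _ F0)/H/(mult_geP _ _ G0).
Qed.

Lemma mult_linform A v G : A \in unitmx -> G != 0 ->
  mult (v *m A) (subst (linform (invmx A)) G) = mult v G.
Proof.
move=> uA G0; have K1 : subst (linform A) (subst (linform (invmx A)) G) = G.
  by rewrite subst_linform mulmxV // subst_linform1.
apply: eq_mult => // [|m].
  by apply: contraNneq G0 => e; rewrite -K1 e raddf0.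
split=> H; first by rewrite -K1; apply: vanishes_linform.
by apply: vanishes_linform; rewrite mulmxK.
Qed.

(** Scaling the coordinates multiplies a homogeneous polynomial by a scalar, so
    the multiplicity is a function of the point of projective space. *)
Lemma mult_scale e v G (t : K) : t != 0 -> G != 0 -> G \is e.-homog ->
  mult (t *: v) G = mult v G.
Proof.
move=> t0 G0 He.
have scal c : subst (linform c%:M) G = c ^+ e *: G.
  rewrite {2}[G]mpolyE scaler_sumr substE big_seq [RHS]big_seq.
  apply: eq_bigr => a aG; rewrite scalerA mulrC -scalerA; congr (_ *: _).
  rewrite -(homog_mdeg He aG) mpolyXE_id mdegE -prodrXr -scaler_prod.
  apply: eq_bigr => i _; rewrite -exprZn; congr (_ ^+ _).
  rewrite /linform (bigD1 i) //= mxE eqxx mulr1n big1 ?addr0 // => l li.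
  by rewrite mxE (negbTE li) scale0r.
have dir c w m : c != 0 -> vanishes m (c *: w) G -> vanishes m w G.
  move=> c0; rewrite -mul_mx_scalar => /vanishes_linform; rewrite scal /vanishes.
  rewrite linearZ /= => /(ord_geZ (c ^- e)); rewrite scalerA mulVf ?scale1r //.
  by rewrite expf_neq0.
apply: eq_mult => // m; split; first exact: dir.
move=> H; apply: (dir t^-1); rewrite ?invr_eq0 // scalerA mulVf // scale1r //.
Qed.

(** Setting X_i := 1 keeps distinct monomials of a homogeneous polynomial
    distinct, so no cancellation can raise the order of vanishing: it is read off
    from the largest exponent of X_i. *)
Lemma vanishes_coord m e (i : 'I_n.+1) G : G \is e.-homog ->
  vanishes m (delta_mx 0 i) G <-> (forall a, a \in msupp G -> (a i + m <= e)%N).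
Proof.
move=> He.
have dege a : a \in msupp G -> (a i + \sum_(l | l != i) a l = e)%N.
  by move=> aG; rewrite -(homog_mdeg He aG) mdegE [RHS](bigD1 i).
split=> [H a aG|H].
  pose h l : {mpoly K[n.+1]} := if l == i then 1 else 'X_l.
  have : vanishes m (0 : 'rV_n.+1) (subst h G).
    apply: vanishes_subst H => l; rewrite /h mxE eqxx /=.
    by case: eqP => _; rewrite ?meval1 ?mevalXU ?mxE.
  have id0 P : subst (translate (0 : 'rV_n.+1)) P = P.
    rewrite -[RHS]subst_id; apply: eq_subst => l.
    by rewrite /translate mxE mpolyC0 addr0.
  rewrite /vanishes id0 => {}H.
  pose drop (b : 'X_{1..n.+1}) : 'X_{1..n.+1} :=
    [multinom if l == i then 0%N else b l | l < n.+1].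
  have dropX (b : 'X_{1..n.+1}) : \prod_l h l ^+ b l = 'X_[drop b].
    rewrite mpolyXE_id; apply: eq_bigr => l _; rewrite /h mnmE.
    by case: eqP => _; rewrite ?expr1n ?expr0.
  have drop_deg (b : 'X_{1..n.+1}) : mdeg (drop b) = (\sum_(l | l != i) b l)%N.
    rewrite mdegE (bigD1 i) //= mnmE eqxx add0n; apply: eq_bigr => l li.
    by rewrite mnmE (negbTE li).
  have drop_inj (b c : 'X_{1..n.+1}) : b \in msupp G -> c \in msupp G -> drop b = drop c -> b = c.
    move=> bG cG e1; apply/mnmP => l; have [->|li] := eqVneq l i.
      have := dege b bG; have := dege c cG.
      by rewrite -!drop_deg e1 => <- /addIn.
    by have /mnmP/(_ l) := e1; rewrite !mnmE (negbTE li).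
  rewrite leqNgt; apply/negP => lt.
  have /H : (mdeg (drop a) < m)%N.
    by rewrite drop_deg; have := dege a aG; lia.
  rewrite substE raddf_sum (big_rem a) //= dropX mcoeffZ mcoeffX eqxx mulr1.
  rewrite big_seq big1 ?addr0 => [/eqP|b]; first by rewrite mcoeff_eq0 aG.
  rewrite mem_rem_uniq ?msupp_uniq // inE => /andP[ba bG].
  rewrite dropX mcoeffZ mcoeffX (negPf (_ : drop b != drop a)) ?mulr0 //.
  by apply: contraNneq ba => /drop_inj ->.
rewrite /vanishes substE big_seq.
apply: (big_ind (ord_ge m)) => [b|P Q HP HQ|a aG].
- by rewrite mcoeff0.
- by move=> b bm; rewrite mcoeffD HP ?HQ ?addr0.
have le : (m <= \sum_l if l == i then 0 else a l)%N.
  rewrite (bigD1 i) //= eqxx add0n.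
  rewrite (eq_bigr (fun l => a l)) => [|l /negbTE -> //].
  by have := H a aG; rewrite -(dege a aG) leq_add2l.
apply: ord_geZ; apply: ord_ge_leq le _; apply: ord_ge_prod => l.
case: eqP => [_|/eqP li]; first exact: ord_ge0.
have /ord_geX : ord_ge 1 (translate (delta_mx 0 i) l : {mpoly K[n.+1]}).
  by apply/ord_ge1P; rewrite /translate mxE eqxx (negbTE li) mpolyC0 addr0 mcoeffX mnm1_eq0.
by move=> /(_ (a l)); rewrite mul1n.
Qed.
End ProjMult.

(** * Inverting the variables of a polynomial *)

Section Inversion.
Variables (K : fieldType) (n : nat).
Implicit Types (P Q G : {mpoly K[n]}) (D E a b : 'X_{1..n}) (i : 'I_n).

(** The polynomial X^D P(1/X_1, .., 1/X_n), for P of multidegree at most D. *)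
Definition invert D P : {mpoly K[n]} :=
  \sum_(b : 'X_{1..n < (mdeg D).+1} | (b <= D)%MM) P@_(D - b) *: 'X_[b].

Definition bounded D P := forall a, a \in msupp P -> (a <= D)%MM.

Lemma mdeg_le a D : (a <= D)%MM -> (mdeg a <= mdeg D)%N.
Proof. by move=> /mnm_lepP H; rewrite !mdegE leq_sum. Qed.

Lemma mcoeff_invert D P a :
  (invert D P)@_a = if (a <= D)%MM then P@_(D - a) else 0.
Proof.
rewrite /invert raddf_sum /=; case: ifP => aD.
  have ad : (mdeg a < (mdeg D).+1)%N by rewrite ltnS mdeg_le.
  rewrite (bigD1 (BMultinom ad)) //= mcoeffZ mcoeffX eqxx mulr1.
  rewrite big1 ?addr0 // => b /andP[_ ba].
  by rewrite mcoeffZ mcoeffX; move: ba; rewrite bmeqP => /negbTE -> ; rewrite mulr0.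
rewrite big1 // => b bD; rewrite mcoeffZ mcoeffX.
by case: eqP => [e|]; rewrite ?mulr0 //; move: aD; rewrite -e bD.
Qed.

Lemma msupp_invert D P a :
  (a \in msupp (invert D P)) = (a <= D)%MM && ((D - a)%MM \in msupp P).
Proof. by rewrite !mcoeff_msupp mcoeff_invert; case: ifP; rewrite ?eqxx. Qed.

Lemma subsubm a D : (a <= D)%MM -> (D - (D - a) = a)%MM.
Proof. by move=> /mnm_lepP H; apply/mnmP => i; rewrite !mnmBE subKn. Qed.

Lemma bounded_invert D P : bounded D (invert D P).
Proof. by move=> a; rewrite msupp_invert => /andP[]. Qed.

Lemma invertK D P : bounded D P -> invert D (invert D P) = P.
Proof.
move=> H; apply/mpolyP => a; rewrite !mcoeff_invert lem_subr.
case: ifP => [aD|aD]; first by rewrite subsubm.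
by apply/esym/memN_msupp_eq0; apply: contraFN aD => /H.
Qed.

Lemma invert_linear D c P Q :
  invert D (c *: P + Q) = c *: invert D P + invert D Q.
Proof.
apply/mpolyP => a; rewrite mcoeffD mcoeffZ !mcoeff_invert mcoeffD mcoeffZ.
by case: ifP => // _; rewrite mulr0 addr0.
Qed.
HB.instance Definition _ D := GRing.isLinear.Build K {mpoly K[n]} {mpoly K[n]}
  _ (invert D) (fun c => invert_linear D c).

Lemma invertX D a : (a <= D)%MM -> invert D 'X_[a] = 'X_[D - a].
Proof.
move=> aD; apply/mpolyP => b; rewrite mcoeff_invert !mcoeffX.
case: ifP => bD.
  congr (_ %:R); congr nat_of_bool.
  by apply/eqP/eqP => [->|<-]; rewrite subsubm.
by case: eqP => // e; move: bD; rewrite -e lem_subr.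
Qed.

Lemma invertM D E P Q : bounded D P -> bounded E Q ->
  invert (D + E) (P * Q) = invert D P * invert E Q.
Proof.
move=> HP HQ; rewrite {1 2}[P]mpolyE {1 2}[Q]mpolyE.
rewrite mulr_suml !raddf_sum mulr_suml /=.
rewrite big_seq [RHS]big_seq; apply: eq_bigr => a /HP aD.
rewrite mulr_sumr !raddf_sum mulr_sumr /=.
rewrite big_seq [RHS]big_seq; apply: eq_bigr => b /HQ bE.
rewrite -scalerAl -scalerAr scalerA -mpolyXD !linearZ /= !invertX //; last first.
  by apply/mnm_lepP => i; rewrite !mnmDE leq_add // ?(mnm_lepP aD) ?(mnm_lepP bE).
rewrite -scalerAl -scalerAr scalerA -mpolyXD; congr (_ *: 'X_[_]).
apply/mnmP => i; rewrite !(mnmDE, mnmBE).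
by have /mnm_lepP/(_ i) := aD; have /mnm_lepP/(_ i) := bE; lia.
Qed.

Lemma invertC D (c : K) : invert D c%:MP = c *: 'X_[D].
Proof.
rewrite -[c%:MP]mulr1 mul_mpolyC linearZ /= -mpolyX0 invertX ?subm0 //.
by apply/mnm_lepP => i; rewrite mnm0E.
Qed.

Lemma invertDm D E P : bounded D P -> invert (D + E) P = 'X_[E] * invert D P.
Proof.
move=> HP; rewrite -{1}[P]mulr1 invertM //; last first.
  by move=> a; rewrite msupp1 inE => /eqP ->; apply/mnm_lepP => i; rewrite mnm0E.
by rewrite -mpolyC1 invertC scale1r mulrC.
Qed.

(** The multidegree: the degree in each variable. *)
Definition topdeg P : 'X_{1..n} := [multinom \max_(a <- msupp P) a i | i < n].

Lemma topdeg_bounded P : bounded (topdeg P) P.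
Proof.
move=> a aP; apply/mnm_lepP => i; rewrite mnmE.
exact: (@leq_bigmax_seq _ _ xpredT (fun a : 'X_{1..n} => a i) a).
Qed.

Lemma topdeg_attained P i : P != 0 -> exists2 a, a \in msupp P & a i = topdeg P i.
Proof.
rewrite -msupp_eq0 mnmE; elim: (msupp P) => // a [|b r] IH _.
  by exists a; rewrite ?mem_head // big_seq1.
case: IH => // c cr e; rewrite big_cons -e /maxn; case: ifP => _.
  by exists c => //; rewrite inE cr orbT.
by exists a => //; rewrite mem_head.
Qed.

Definition not_div i P := has (fun a : 'X_{1..n} => a i == 0%N) (msupp P).

(** Setting X_i := 0 is a ring morphism to a domain, which makes the condition
    multiplicative. *)
Lemma not_div_subst i P :
  not_div i P = (subst (fun l => if l == i then 0 else 'X_l) P != 0).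
Proof.
have mono (a : 'X_{1..n}) : \prod_l (if l == i then 0 else 'X_l) ^+ a l =
    (if a i == 0%N then 'X_[a] else 0) :> {mpoly K[n]}.
  case: eqP => [a0|/eqP a0].
    rewrite mpolyXE_id; apply: eq_bigr => l _.
    by case: eqP => // ->; rewrite a0 !expr0.
  by rewrite (bigD1 i) //= eqxx expr0n (negbTE a0) mul0r.
rewrite substE; apply/idP/idP => [/hasP[a aP a0]|].
  apply: contraTneq aP => /(congr1 (mcoeff a)); rewrite mcoeff0 raddf_sum /=.
  case: (boolP (a \in msupp P)) => // aP.
  rewrite (big_rem a) //= mono a0 mcoeffZ mcoeffX eqxx mulr1.
  rewrite big_seq big1 ?addr0 => [/eqP|b]; first by rewrite mcoeff_eq0 aP.
  rewrite mem_rem_uniq ?msupp_uniq // inE => /andP[ba bG].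
  rewrite mono mcoeffZ; case: ifP => _; rewrite ?mcoeff0 ?mulr0 //.
  by rewrite mcoeffX (negbTE ba) mulr0.
apply: contraNT => /hasPn H; apply/eqP; rewrite big_seq big1 // => a /H /negbTE a0.
by rewrite mono a0 scaler0.
Qed.

Lemma not_divM i P Q : not_div i (P * Q) = not_div i P && not_div i Q.
Proof. by rewrite !not_div_subst rmorphM /= mulf_eq0 negb_or. Qed.

Lemma not_divZX i c a : not_div i (c *: 'X_[a]) -> a i = 0%N.
Proof.
move=> /hasP[b /msuppZ_le]; rewrite msuppX inE => /eqP -> /eqP //.
Qed.

Lemma not_div_invert i P : P != 0 -> not_div i (invert (topdeg P) P).
Proof.
move=> P0; have [a aP e] := topdeg_attained i P0.
have aD := topdeg_bounded aP.
apply/hasP; exists (topdeg P - a)%MM; last by rewrite mnmBE e subnn.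
by rewrite msupp_invert lem_subr subsubm.
Qed.

Lemma invert_unit D P : bounded D P -> (forall i, not_div i P) ->
  invert D P \is a GRing.unit -> P \is a GRing.unit.
Proof.
move=> HP nP /unit_mpolyP[c c0 e].
have eP : P = c *: 'X_[D] by rewrite -invertC -e invertK.
have -> : P = c%:MP; last exact: unit_mpolyC.
rewrite eP (_ : D = 0%MM) ?mpolyX0 -?mul_mpolyC ?mulr1 //.
by apply/mnmP => i; rewrite mnm0E; apply: (@not_divZX i c); rewrite -eP.
Qed.

(** Inversion preserves irreducibility: inverting the factors of the inverted
    polynomial gives back a factorization up to a monomial, and that monomial
    is trivial because no variable divides the factors. *)
Lemma invert_irreducible G : (forall i, not_div i G) -> irreducible_elt G ->
  irreducible_elt (invert (topdeg G) G).
Proof.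
move=> nG [G0 GU GI]; set D := topdeg G; have HG : bounded D G := @topdeg_bounded G.
have G'0 : invert D G != 0.
  by apply: contraNneq G0 => e; rewrite -(invertK HG) e raddf0.
split=> //; first by apply: contraNN GU; apply: invert_unit.
move=> a b e; have [a0 b0] : a != 0 /\ b != 0.
  by split; apply: contraNneq G'0; rewrite e => ->; rewrite ?mul0r ?mulr0.
have nab i : not_div i a && not_div i b by rewrite -not_divM -e not_div_invert.
have Ha := @topdeg_bounded a; have Hb := @topdeg_bounded b.
set u := invert (topdeg a) a; set v := invert (topdeg b) b.
have uv : u * v = invert (topdeg a + topdeg b) (invert D G) by rewrite e invertM.
have leD : (D <= topdeg a + topdeg b)%MM.
  apply/mnm_lepP => i; have /hasP[c cG /eqP c0] := nG i.
  have : (D - c)%MM \in msupp (invert D G).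
    by rewrite msupp_invert lem_subr subsubm ?HG.
  rewrite e => /msuppM_le/allpairsP[[x y] /= [xa yb exy]].
  have /mnmP/(_ i) := exy; rewrite mnmBE c0 subn0 => ->; rewrite !mnmDE.
  by rewrite leq_add // ?(mnm_lepP (Ha _ xa)) ?(mnm_lepP (Hb _ yb)).
have uvG : u * v = 'X_[topdeg a + topdeg b - D] * G.
  rewrite uv -[G in RHS](invertK HG) -invertDm; last exact: bounded_invert.
  by rewrite [in RHS]addmC submK.
have {}uvG : G = u * v.
  rewrite uvG (_ : (_ - D)%MM = 0%MM) ?mpolyX0 ?mul1r //.
  apply/mnmP => i; rewrite mnm0E; apply: (@not_divZX i 1); rewrite scale1r.
  have : not_div i (u * v) by rewrite not_divM !not_div_invert.
  by rewrite uvG not_divM => /andP[].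
have /orP[/invert_unit|/invert_unit] := GI _ _ uvG.
  by move=> -> //; move=> i; case/andP: (nab i).
by move=> ->; rewrite ?orbT //; move=> i; case/andP: (nab i).
Qed.

Lemma invert_homog D e G : G \is e.-homog -> invert D G \is (mdeg D - e).-homog.
Proof.
move=> He; apply/dhomogP => a; rewrite msupp_invert => /andP[aD /(homog_mdeg He)].
by move=> <-; rewrite -{1}(submK aD) mdegD addKn.
Qed.
End Inversion.

(** * The lattice of divisor classes *)

Section PicTheory.
Variables (n s : nat).
Implicit Types (D E : Pic s) (j k : 'I_s).

Lemma Pic_eq D E : deg D = deg E -> (forall j, mlt D j = mlt E j) -> D = E.
Proof.
by case: D E => [d m] [e m'] /= -> H; congr (_, _); apply/ffunP.
Qed.

Lemma degD D E : deg (D + E) = deg D + deg E. Proof. by []. Qed.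
Lemma mltD D E j : mlt (D + E) j = mlt D j + mlt E j.
Proof. by rewrite /mlt ffunE. Qed.
Lemma degN D : deg (- D) = - deg D. Proof. by []. Qed.
Lemma mltN D j : mlt (- D) j = - mlt D j.
Proof. by rewrite /mlt ffunE. Qed.
Lemma mlt0 j : mlt (0 : Pic s) j = 0.
Proof. by rewrite /mlt ffunE. Qed.

Lemma degMn D c : deg (D *+ c) = deg D *+ c.
Proof. by elim: c => // c IH; rewrite !mulrS degD IH. Qed.
Lemma mltMn D c j : mlt (D *+ c) j = mlt D j *+ c.
Proof. elim: c => [|c IH]; first by rewrite !mulr0n mlt0.
 rewrite !mulrS mltD IH.
by []. Qed.
Lemma degMz D (c : int) : deg (D *~ c) = deg D * c.
Proof.
by case: c => c; rewrite ?NegzE ?mulrNz ?degN -!pmulrn degMn -mulr_natr ?mulrN ?natz.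
Qed.
Lemma mltMz D (c : int) j : mlt (D *~ c) j = mlt D j * c.
Proof.
by case: c => c; rewrite ?NegzE ?mulrNz ?mltN -!pmulrn mltMn -mulr_natr ?mulrN ?natz.
Qed.

Lemma deg_dclass d (m : 'I_s -> int) : deg (dclass d m) = d. Proof. by []. Qed.
Lemma mlt_dclass d (m : 'I_s -> int) j : mlt (dclass d m) j = m j.
Proof. by rewrite /mlt ffunE. Qed.

Lemma mltE j k : mlt (Ecl j) k = - (k == j)%:R.
Proof. exact: mlt_dclass. Qed.

Lemma pairingC D E : pairing n D E = pairing n E D.
Proof.
rewrite /pairing mulrAC; congr (_ - _).
by apply: eq_bigr => j _; rewrite mulrC.
Qed.

Lemma pairingDl D D' E : pairing n (D + D') E = pairing n D E + pairing n D' E.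
Proof.
rewrite /pairing degD mulrDr mulrDl addrACA -opprD -big_split /=.
by congr (_ - _); apply: eq_bigr => j _; rewrite mltD mulrDl.
Qed.

Lemma pairingMzl D E (c : int) : pairing n (D *~ c) E = pairing n D E * c.
Proof.
rewrite /pairing degMz [RHS]mulrBl mulr_suml; congr (_ - _); first by ring.
by apply: eq_bigr => j _; rewrite mltMz mulrAC.
Qed.

Lemma pairingDr D D' E : pairing n E (D + D') = pairing n E D + pairing n E D'.
Proof. by rewrite !(pairingC E) pairingDl. Qed.

Lemma pairingMzr D E (c : int) : pairing n E (D *~ c) = pairing n E D * c.
Proof. by rewrite !(pairingC E) pairingMzl. Qed.

Lemma pairingMnl D E (c : nat) : pairing n (D *+ c) E = pairing n D E *+ c.
Proof. by rewrite pmulrn pairingMzl -mulr_natr natz. Qed.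

Lemma pairingE D j : pairing n D (Ecl j) = mlt D j.
Proof.
rewrite /pairing mulr0 sub0r (bigD1 j) //= mltE eqxx big1 ?addr0 ?mulrN1 ?opprK //.
by move=> k kj; rewrite mltE (negbTE kj) oppr0 mulr0.
Qed.

Lemma adegD D E : adeg n (D + E) = adeg n D + adeg n E.
Proof.
rewrite /adeg degD mulrDr addrACA -opprD -big_split /=.
by congr (_ - _); apply: eq_bigr => j _; rewrite mltD.
Qed.

Lemma adegMz D (c : int) : adeg n (D *~ c) = adeg n D * c.
Proof.
rewrite /adeg degMz mulrBl mulr_suml mulrA; congr (_ - _).
by apply: eq_bigr => j _; rewrite mltMz.
Qed.
End PicTheory.

(** ** The action of a Cremona transformation on classes

    The Cremona transformation based at n+1 points acts by the reflection in the
    root H - E_{f 0} - .. - E_{f n}, whose square is -2 and whose anticanonical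
    degree is 0. *)

Section Reflection.
Variables (n s : nat) (f : 'I_n.+1 -> 'I_s).
Hypothesis f_inj : injective f.

Definition cremona_root : Pic s := dclass 1 (fun j => (j \in codom f)%:R).

Definition cremona (D : Pic s) : Pic s := D + cremona_root *~ pairing n D cremona_root.

Lemma sum_codom (F : 'I_s -> int) :
  \sum_j F j * (j \in codom f)%:R = \sum_i F (f i).
Proof.
rewrite (eq_bigr (fun j => if j \in codom f then F j else 0)); last first.
  by move=> j _; case: ifP; rewrite ?mulr1 ?mulr0.
rewrite -big_mkcond -big_uniq /=; last by rewrite map_inj_uniq ?enum_uniq.
by rewrite big_image.
Qed.

Lemma pairing_root D :
  pairing n D cremona_root = (n%:Z - 1) * deg D - \sum_i mlt D (f i).
Proof.
rewrite /pairing mulr1 -sum_codom; congr (_ - _).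
by apply: eq_bigr => j _; rewrite mlt_dclass.
Qed.

Lemma root_root : pairing n cremona_root cremona_root = - 2.
Proof.
rewrite pairing_root deg_dclass (eq_bigr (fun=> 1)) => [|i _].
  by rewrite sumr_const card_ord; lia.
by rewrite mlt_dclass codom_f.
Qed.

Lemma adeg_root : adeg n cremona_root = 0.
Proof.
rewrite /adeg deg_dclass mulr1.
have := sum_codom (fun=> 1); rewrite sumr_const card_ord => e.
rewrite (eq_bigr (fun j => 1 * (j \in codom f)%:R)) ?e; first by lia.
by move=> j _; rewrite mlt_dclass mul1r.
Qed.

Lemma cremonaD D E : cremona (D + E) = cremona D + cremona E.
Proof. by rewrite /cremona pairingDl mulrzDr addrACA. Qed.
Lemma cremona0 : cremona 0 = 0.
Proof. by apply: (addrI (cremona 0)); rewrite -cremonaD !addr0. Qed.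
Lemma cremonaN D : cremona (- D) = - cremona D.
Proof. by apply: (addrI (cremona D)); rewrite -cremonaD !addrN cremona0. Qed.
Lemma cremonaMn D k : cremona (D *+ k) = cremona D *+ k.
Proof. by elim: k => [|k IH]; rewrite ?mulr0n ?cremona0 // !mulrS cremonaD IH. Qed.

Lemma cremonaK D : cremona (cremona D) = D.
Proof.
rewrite /cremona pairingDl pairingMzl root_root -addrA -mulrzDr.
by rewrite (_ : pairing n D cremona_root + _ = 0) ?mulr0z ?addr0 //; ring.
Qed.

Lemma pairing_cremona D E : pairing n (cremona D) (cremona E) = pairing n D E.
Proof.
rewrite /cremona !(pairingDl, pairingDr, pairingMzl, pairingMzr) root_root.
by rewrite (pairingC _ cremona_root E); ring.
Qed.

Lemma adeg_cremona D : adeg n (cremona D) = adeg n D.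
Proof. by rewrite /cremona adegD adegMz adeg_root mul0r addr0. Qed.

Lemma deg_cremona D : deg (cremona D) = deg D + pairing n D cremona_root.
Proof. by rewrite /cremona degD degMz deg_dclass mul1r. Qed.

Lemma mlt_cremona D j :
  mlt (cremona D) j = mlt D j + (j \in codom f)%:R * pairing n D cremona_root.
Proof. by rewrite /cremona mltD mltMz mlt_dclass. Qed.

Lemma cremona_exc_out j : j \notin codom f -> cremona (Ecl j) = Ecl j.
Proof.
move=> jf; rewrite /cremona pairingC pairingE mlt_dclass (negbTE jf).
by rewrite mulr0z addr0.
Qed.

Lemma cremona_exc i : cremona (Ecl (f i)) = cremona_root + Ecl (f i).
Proof. by rewrite /cremona pairingC pairingE mlt_dclass codom_f mulr1z addrC. Qed.
End Reflection.

(** ** Transport of prime divisors *)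

Section Transport.
Variables (K : fieldType) (n s : nat).
Implicit Types (p q r : 'M[K]_(s, n.+1)) (T U : Pic s -> Pic s).

(** What remains, at the level of classes, of an isomorphism in codimension one
    between the blow-ups in p and q whose action on divisor classes is T. *)
Definition maps_primes p q T :=
  forall P : prime_divisor K n s, exists P' : prime_divisor K n s,
    prime_class q P' = T (prime_class p P).

Lemma maps_primes_comp p q r T U : maps_primes p q T -> maps_primes q r U ->
  maps_primes p r (U \o T).
Proof.
move=> H H' P; have [P1 e1] := H P; have [P2 e2] := H' P1.
by exists P2; rewrite e2 e1.
Qed.

Lemma divisor_class_nseq p k (P : prime_divisor K n s) :
  divisor_class p (nseq k P) = prime_class p P *+ k.
Proof. by rewrite /divisor_class big_nseq; elim: k => //= k ->; rewrite mulrS. Qed.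

Lemma effective_irreducibleP p D : effective_irreducible p D <->
  exists k P, D = prime_class p P *+ k.+1.
Proof.
split=> [[A <- [k [P ->]]]|[k [P ->]]]; first by exists k, P; rewrite divisor_class_nseq.
by exists (nseq k.+1 P); rewrite ?divisor_class_nseq //; exists k, P.
Qed.

Lemma maps_irreducible p q T D : (forall D k, T (D *+ k) = T D *+ k) ->
  maps_primes p q T -> effective_irreducible p D -> effective_irreducible q (T D).
Proof.
move=> TM H /effective_irreducibleP[k [P ->]]; have [P' e] := H P.
by apply/effective_irreducibleP; exists k, P'; rewrite TM e.
Qed.

Lemma maps_effective p q T D : (forall D E, T (D + E) = T D + T E) -> T 0 = 0 ->
  maps_primes p q T -> effective p D -> effective q (T D).
Proof.
move=> TD T0 H [A <-]; elim: A => [|P A [A' IH]].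
  by exists [::]; rewrite /divisor_class !big_nil T0.
have [P' e] := H P; exists (P' :: A').
by rewrite /divisor_class !big_cons TD e -/(divisor_class _ _) IH.
Qed.

Lemma prime_class_strict p e G (He : G \is e.-homog) (Gi : irreducible_elt G) :
  prime_class p (StrictTransform s He Gi) =
  dclass e%:Z (fun j => (mult (row j p) G)%:Z).
Proof. by []. Qed.

Lemma maps_linear p (A : 'M[K]_n.+1) : A \in unitmx -> maps_primes p (p *m A) id.
Proof.
move=> uA [j|e G He Gi]; first by exists (Exceptional _ _ j).
pose g := subst (linform A); pose g' := subst (linform (invmx A)).
have K1 : cancel g' g by move=> P; rewrite /g subst_linform mulmxV // subst_linform1.
have K2 : cancel g g' by move=> P; rewrite /g' subst_linform mulVmx // subst_linform1.
have Gi' : irreducible_elt (g' G).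
  exact: (@irreducible_iso _ _ (subst (linform (invmx A))) (subst (linform A))).
have He' : g' G \is e.-homog by apply: homog_subst_linear => // i; apply: linform_homog.
exists (StrictTransform s He' Gi'); rewrite !prime_class_strict.
have [G0 _ _] := Gi.
apply: Pic_eq => [|j]; first by rewrite !deg_dclass.
by rewrite !mlt_dclass row_mul (mult_linform _ uA G0).
Qed.
End Transport.

(** * The standard Cremona transformation on prime divisors *)

Section StandardCremona.
Variables (K : fieldType) (n : nat).
Implicit Types (G : {mpoly K[n.+1]}) (v w : 'rV[K]_n.+1) (i : 'I_n.+1).

Lemma mult_coord e i G : G != 0 -> G \is e.-homog ->
  mult (delta_mx 0 i) G = (e - topdeg G i)%N.
Proof.
move=> G0 He; have [a aG ea] := topdeg_attained i G0.
have le : (topdeg G i <= e)%N.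
  by rewrite -ea -(homog_mdeg He aG) mdegE (bigD1 i) //= leq_addr.
apply/eqP; rewrite eqn_leq; apply/andP; split.
  have /(mult_geP _ _ G0)/(vanishes_coord _ _ He)/(_ a aG) := leqnn (mult (delta_mx 0 i) G).
  by rewrite ea; lia.
apply/(mult_geP _ _ G0)/(vanishes_coord _ _ He) => b bG.
by have /mnm_lepP/(_ i) := topdeg_bounded bG; lia.
Qed.

(** Composing G with the standard Cremona map x |-> (prod_(l != i) x_l)_i yields
    the inverted polynomial up to a monomial, which is nonzero off the
    coordinate hyperplanes; and this map is locally x |-> 1/x up to scaling. *)
Lemma vanishes_invert m e (D : 'X_{1..n.+1}) v w t G :
  G != 0 -> G \is e.-homog -> bounded D G -> (D <= [multinom e | _ < n.+1])%MM ->
  t != 0 -> (forall i, v 0 i * w 0 i = t) ->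
  vanishes m v G -> vanishes m w (invert D G).
Proof.
move=> G0 He HD De t0 vw Hv.
have w0 i : w 0 i != 0.
  by apply: contraNneq t0 => e0; rewrite -(vw i) e0 mulr0.
pose phi i : {mpoly K[n.+1]} := \prod_(l | l != i) 'X_l.
pose c := (\prod_l w 0 l) / t.
have c0 : c != 0 by rewrite mulf_neq0 ?invr_eq0 //; apply/prodf_neq0.
have : vanishes m (c *: v) G.
  by apply/(mult_geP _ _ G0); rewrite (mult_scale _ c0 G0 He); apply/(mult_geP _ _ G0).
move=> /(@vanishes_subst _ _ _ _ phi _ w) H.
have {H} : vanishes m w (subst phi G).
  apply: H => i; rewrite /phi rmorph_prod /= mxE /c [in RHS](bigD1 i) //= -(vw i).
  under eq_bigr do rewrite mevalXU.
  have vi : v 0 i != 0.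
    by apply: contraNneq t0 => e0; rewrite -(vw i) e0 mul0r.
  by rewrite invfM -[LHS]mulr1 -(mulfV (w0 i)) -[X in X * _]mulr1 -(mulfV vi); ring.
pose E := ([multinom e | _ < n.+1] - D)%MM.
have -> : subst phi G = 'X_[E] * invert D G.
  rewrite {2}[G]mpolyE raddf_sum mulr_sumr substE big_seq [RHS]big_seq /=.
  apply: eq_bigr => a aG; rewrite linearZ /= -scalerAr invertX ?HD //.
  congr (_ *: _); rewrite -mpolyXD.
  have -> : (E + (D - a) = [multinom e - a l | l < n.+1])%MM.
    apply/mnmP => l; rewrite mnmDE !mnmBE !mnmE.
    have /mnm_lepP/(_ l) := De; have /mnm_lepP/(_ l) := HD _ aG.
    by rewrite mnmE; lia.
  rewrite mpolyXE_id /phi.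
  transitivity (\prod_i \prod_(l | l != i) ('X_l ^+ a i : {mpoly K[n.+1]})).
    by apply: eq_bigr => i _; rewrite prodrXl.
  rewrite (exchange_big_dep xpredT) //=; apply: eq_bigr => l _.
  rewrite prodrXr mnmE; congr (_ ^+ _).
  rewrite -(homog_mdeg He aG) mdegE [in RHS](bigD1 l) //= addKn.
  by apply: eq_bigl => i; rewrite eq_sym.
apply: vanishes_cancel; rewrite mevalX; apply/prodf_neq0 => i _.
by rewrite expf_neq0.
Qed.

(** Inversion is an involution, so one inequality between multiplicities yields
    the other. *)
Lemma mult_invert e v w t G :
  G \is e.-homog -> irreducible_elt G -> (forall i, not_div i G) ->
  t != 0 -> (forall i, v 0 i * w 0 i = t) ->
  mult w (invert (topdeg G) G) = mult v G.
Proof.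
move=> He Gi nG t0 vw; have [G0 _ _] := Gi.
have [G'0 _ _] := invert_irreducible nG Gi.
have HD : bounded (topdeg G) G := @topdeg_bounded _ _ G.
have De : (topdeg G <= [multinom e | _ < n.+1])%MM.
  apply/mnm_lepP => i; rewrite [X in (_ <= X)%N]mnmE.
  have [a aG <-] := topdeg_attained i G0.
  by rewrite -(homog_mdeg He aG) mdegE (bigD1 i) //= leq_addr.
have He' := invert_homog (topdeg G) He.
have De' : (topdeg G <= [multinom mdeg (topdeg G) - e | _ < n.+1])%MM.
  apply/mnm_lepP => i; rewrite [X in (_ <= X)%N]mnmE.
  have /hasP[a aG /eqP ai] := nG i.
  rewrite -(homog_mdeg He aG) -{2}(submK (HD _ aG)) mdegD addnK mdegE.
  by rewrite (bigD1 i) //= mnmBE ai subn0 leq_addr.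
apply: eq_mult => // m; split; last exact: vanishes_invert De t0 vw.
have wv i : w 0 i * v 0 i = t by rewrite mulrC.
by move/(vanishes_invert G'0 He' (@bounded_invert _ _ _ G) De' t0 wv); rewrite invertK.
Qed.

Lemma not_divN i G : irreducible_elt G -> ~~ not_div i G ->
  exists2 c, c != 0 & G = c *: 'X_i.
Proof.
move=> [G0 GU GI] nG.
have leU a : a \in msupp G -> (U_(i) <= a)%MM.
  by move=> aG; rewrite lep1mP; apply: contraNN nG => a0; apply/hasP; exists a.
pose Q : {mpoly K[n.+1]} := \sum_(a <- msupp G) G@_a *: 'X_[a - U_(i)].
have eG : G = 'X_i * Q.
  rewrite {1}[G]mpolyE mulr_sumr big_seq [RHS]big_seq; apply: eq_bigr => a aG.
  by rewrite -scalerAr -mpolyXD addmC submK ?leU.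
have /orP[/unit_mpolyP[c c0 e]|/unit_mpolyP[c c0 e]] := GI _ _ eG.
  have : msize ('X_i : {mpoly K[n.+1]}) = msize (c%:MP : {mpoly K[n.+1]}) by rewrite e.
  by rewrite msizeX mdeg1 msizeC c0.
by exists c => //; rewrite eG e mulrC mul_mpolyC.
Qed.

Variables (s : nat) (f : 'I_n.+1 -> 'I_s).
Hypothesis f_inj : injective f.

Definition coord_points (p : 'M[K]_(s, n.+1)) := forall i, row (f i) p = delta_mx 0 i.

(** Proportionality to the inverse, rather than equality, makes the relation
    symmetric and independent of the homogeneous coordinates. *)
Definition inverse_points (p q : 'M[K]_(s, n.+1)) :=
  forall k, k \notin codom f -> exists2 t, t != 0 & forall i, p k i * q k i = t.

Lemma inverse_pointsC p q : inverse_points p q -> inverse_points q p.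
Proof.
by move=> H k /H[t t0 e]; exists t => // i; rewrite mulrC.
Qed.

(** The coordinate hyperplanes, which pass through all but one of the coordinate
    points, are exchanged with the exceptional divisors. *)
Lemma prime_class_coordX p q c i e (He : c *: 'X_i \is e.-homog)
    (Gi : irreducible_elt (c *: 'X_i)) : coord_points p -> inverse_points p q ->
  prime_class p (StrictTransform s He Gi) = cremona f (Ecl (f i)).
Proof.
move=> Hp pq; have [G0 _ _] := Gi.
have c0 : c != 0 by apply: contraNneq G0 => ->; rewrite scale0r.
have H1 : c *: 'X_i \is 1.-homog by apply: rpredZ; rewrite dhomogX /= mdeg1.
have e1 : e = 1%N := dhomog_uniq G0 He H1.
rewrite prime_class_strict cremona_exc //; apply: Pic_eq => [|k].
  by rewrite degD !deg_dclass e1.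
rewrite mltD mltE !mlt_dclass mult_linear // mevalZ mevalXU mulf_eq0 (negbTE c0) /=.
have [/codomP[l ->]|kf] := boolP (k \in codom f).
  rewrite Hp mxE eqxx /= (inj_eq f_inj) [l == i]eq_sym.
  by case: (i == l); rewrite ?oner_eq0 ?eqxx.
have [t t0 pqk] := pq k kf; rewrite mxE.
have /negbTE -> : p k i != 0.
  by apply: contraNneq t0 => e0; rewrite -(pqk i) e0 mul0r.
by case: eqP kf => // ->; rewrite codom_f.
Qed.

(** The coordinate hyperplanes and the exceptional divisors over the coordinate
    points are exchanged; the equation of any other hypersurface is inverted, its
    degree in X_i being its degree minus its multiplicity at the i-th coordinate
    point. *)
Lemma maps_standard_cremona p q : coord_points p -> coord_points q ->
  inverse_points p q -> maps_primes p q (cremona f).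
Proof.
move=> Hp Hq pq [j|e G He Gi].
  have [/codomP[i ->]|jf] := boolP (j \in codom f); last first.
    by exists (Exceptional _ _ j); rewrite /= cremona_exc_out.
  have H1 : (1 : K) *: 'X_i \is 1.-homog by apply: rpredZ; rewrite dhomogX /= mdeg1.
  have X0 : (1 : K) *: 'X_i != 0 :> {mpoly K[n.+1]}.
    by rewrite scale1r -msize_poly_eq0 msizeX.
  exists (StrictTransform s H1 (linear_irreducible X0 H1)).
  by rewrite (prime_class_coordX _ _ Hq (inverse_pointsC pq)).
case: (boolP [forall i, not_div i G]) => [/forallP nG|]; last first.
  rewrite negb_forall => /existsP[i /(not_divN Gi)[c c0 eG]]; subst G.
  exists (Exceptional _ _ (f i)).
  by rewrite (prime_class_coordX _ _ Hp pq) cremonaK.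
have [G0 _ _] := Gi; set D := topdeg G.
have HD : bounded D G := @topdeg_bounded _ _ G.
have He' := invert_homog D He; have Gi' := invert_irreducible nG Gi.
have [G'0 _ _] := Gi'.
exists (StrictTransform s He' Gi'); rewrite !prime_class_strict.
have De i : (D i <= e)%N.
  have [a aG <-] := topdeg_attained i G0.
  by rewrite -(homog_mdeg He aG) mdegE (bigD1 i) //= leq_addr.
have De' : (e <= mdeg D)%N.
  by rewrite -(homog_mdeg He (mlead_supp G0)) mdeg_le // HD ?mlead_supp.
have De2 i : (D i <= mdeg D - e)%N.
  have /hasP[a aG /eqP ai] := nG i.
  rewrite -(homog_mdeg He aG) -{2}(submK (HD _ aG)) mdegD addnK mdegE.
  by rewrite (bigD1 i) //= mnmBE ai subn0 leq_addr.
have topD i : topdeg (invert D G) i = D i.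
  have /hasP[a aG /eqP ai] := nG i.
  have aD : (D - a)%MM \in msupp (invert D G).
    by rewrite msupp_invert lem_subr subsubm ?HD.
  have /mnm_lepP/(_ i) := topdeg_bounded aD; rewrite mnmBE ai subn0 => le.
  have [b /bounded_invert/mnm_lepP/(_ i) leb eb] := topdeg_attained i G'0.
  by apply/eqP; rewrite eqn_leq le -eb leb.
have pr : pairing n (dclass e%:Z (fun j => (mult (row j p) G)%:Z)) (cremona_root f)
            = (mdeg D)%:Z - 2 * e%:Z.
  rewrite pairing_root // deg_dclass (eq_bigr (fun i => e%:Z - (D i)%:Z)) => [|i _].
    rewrite sumrB sumr_const card_ord -(big_morph Posz PoszD erefl) -mdegE.
    have -> : e%:Z *+ n.+1 = e%:Z * (n%:Z + 1) by rewrite -mulr_natr natz -addn1 PoszD.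
    by ring.
  by rewrite mlt_dclass Hp (mult_coord i G0 He) -subzn.
apply: Pic_eq => [|k].
  by rewrite deg_cremona pr !deg_dclass -subzn //; ring.
rewrite mlt_cremona pr !mlt_dclass.
have [/codomP[i ->]|kf] := boolP (k \in codom f).
  rewrite Hp Hq (mult_coord i G0 He) (mult_coord i G'0 He') topD.
  by rewrite -!subzn // mul1r; ring.
have [t t0 pqk] := pq k kf.
rewrite mul0r addr0; congr (Posz _); apply: (mult_invert He Gi nG t0) => i.
by rewrite !mxE.
Qed.
End StandardCremona.

(** * General points *)

(** ** Nonvanishing of polynomials *)

(** If q is not constant then neither is q - 1, and q takes the value 1 at a root
    of q - 1. *)
Lemma poly_nonroot (K : closedFieldType) (q : {poly K}) :
  q != 0 -> exists t, q.[t] != 0.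
Proof.
move=> q0; have [s1|s1] := eqVneq (size q) 1%N.
  exists 0; have /eqP/size_poly1P[c c0 ->] := s1; by rewrite hornerC.
have sq : (1 < size q)%N.
  by case: (size q) (size_poly_eq0 q) s1 => [|[]] //; rewrite (negbTE q0).
have /closed_rootP[t] : size (q - 1) != 1%N.
  by rewrite size_polyDl ?size_polyN ?size_poly1.
by move=> /rootP; rewrite hornerD hornerN hornerC => /eqP; rewrite subr_eq0 => /eqP e;
  exists t; rewrite e oner_eq0.
Qed.

Lemma digits_inj N n (a b : 'I_n -> nat) :
  (forall i, (a i < N)%N) -> (forall i, (b i < N)%N) ->
  (\sum_i a i * N ^ i = \sum_i b i * N ^ i)%N -> a =1 b.
Proof.
elim: n a b => [|n IH] a b aN bN; first by move=> _ [].
rewrite !big_ord_recl /= !muln1.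
have shift (c : 'I_n.+1 -> nat) : (\sum_(i < n) c (lift ord0 i) * N ^ bump 0 i =
    N * \sum_(i < n) c (lift ord0 i) * N ^ i)%N.
  by rewrite big_distrr; apply: eq_bigr => i _ /=; rewrite expnS mulnCA.
rewrite !shift => e.
have e0 : a ord0 = b ord0.
  have := congr1 (modn^~ N) e; rewrite ![(_ + N * _)%N]addnC ![(N * _)%N]mulnC.
  by rewrite !modnMDl !modn_small.
have N0 : (0 < N)%N by apply: leq_ltn_trans (aN ord0).
move: e; rewrite e0 => /addnI/eqP; rewrite eqn_pmul2l // => /eqP e.
have {}IH := IH _ _ (fun i => aN _) (fun i => bN _) e.
by move=> i; case: (unliftP ord0 i) => [j|] -> //; apply: IH.
Qed.

(** The Kronecker substitution X_i := t^(N^i) separates monomials of degree less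
    than N, by uniqueness of base N expansions. *)
Lemma mpoly_nonzero_eval (K : closedFieldType) n (F : {mpoly K[n]}) :
  F != 0 -> exists v, F.@[v] != 0.
Proof.
move=> F0; pose N := msize F.
pose w (a : 'X_{1..n}) := (\sum_i a i * N ^ i)%N.
pose P : {poly K} := \sum_(a <- msupp F) F@_a *: 'X^(w a).
have small a i : a \in msupp F -> (a i < N)%N.
  move=> /msize_mdeg_lt; apply: leq_ltn_trans.
  by rewrite mdegE (bigD1 i) //= leq_addr.
have P0 : P != 0.
  have aF := mlead_supp F0; set a := mlead F in aF.
  apply: contraTneq aF => /(congr1 (fun p : {poly K} => p`_(w a))).
  rewrite coef0 coef_sum; case: (boolP (a \in msupp F)) => // aF.
  rewrite (big_rem a) //= coefZ coefXn eqxx mulr1 big_seq big1 ?addr0 => [/eqP|b].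
    by rewrite mcoeff_eq0 aF.
  rewrite mem_rem_uniq ?msupp_uniq // inE => /andP[ba bF].
  rewrite coefZ coefXn; case: eqP => [e|]; rewrite ?mulr0 //.
  case/eqP: ba; apply/mnmP => i; apply/esym.
  by apply: (digits_inj _ _ e) => j; apply: small.
have [t Pt] := poly_nonroot P0; exists (fun i => t ^+ (N ^ i)).
rewrite (_ : _.@[_] = P.[t]) // mevalE horner_sum; apply: eq_bigr => a _.
rewrite hornerZ hornerXn /w; congr (_ * _); rewrite -prodrXr.
by apply: eq_bigr => i _; rewrite -exprM mulnC.
Qed.

Lemma closed_nth_root (K : closedFieldType) n (c : K) :
  (0 < n)%N -> exists t, t ^+ n = c.
Proof.
move=> n0; have /closed_rootP[t] : size ('X^n - c%:P) != 1%N.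
  by rewrite size_XnsubC // eqSS -lt0n.
move=> /rootP; rewrite hornerD hornerN hornerC hornerXn => /eqP.
by rewrite subr_eq0 => /eqP; exists t.
Qed.

(** ** Polynomial conditions on points *)

Section PolynomialFunctions.
Variables (K : fieldType) (n s : nat).
Implicit Types (h g : 'M[K]_(s, n.+1) -> K).

Definition polyfun h := exists F : {mpoly K[s * n.+1]},
  forall p, h p = F.@[fun k => mxvec p 0 k].

Lemma eq_polyfun h g : h =1 g -> polyfun h -> polyfun g.
Proof. by move=> e [F H]; exists F => p; rewrite -e. Qed.

Lemma polyfunC c : polyfun (fun=> c).
Proof. by exists c%:MP => p; rewrite mevalC. Qed.

Lemma polyfun_entry j l : polyfun (fun p => p j l).
Proof. by exists 'X_(mxvec_index j l) => p; rewrite mevalXU mxvecE. Qed.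

Lemma polyfunD h g : polyfun h -> polyfun g -> polyfun (fun p => h p + g p).
Proof. by move=> [F HF] [G HG]; exists (F + G) => p; rewrite mevalD HF HG. Qed.

Lemma polyfunM h g : polyfun h -> polyfun g -> polyfun (fun p => h p * g p).
Proof. by move=> [F HF] [G HG]; exists (F * G) => p; rewrite mevalM HF HG. Qed.

Lemma polyfun_sum (I : Type) (r : seq I) (P : pred I) (h : I -> 'M[K]_(s, n.+1) -> K) :
  (forall i, polyfun (h i)) -> polyfun (fun p => \sum_(i <- r | P i) h i p).
Proof.
move=> H; elim: r => [|i r IH].
  by apply: eq_polyfun (polyfunC 0) => p; rewrite big_nil.
case: (boolP (P i)) => Pi.
  by apply: eq_polyfun (polyfunD (H i) IH) => p; rewrite big_cons Pi.
by apply: eq_polyfun IH => p; rewrite big_cons (negbTE Pi).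
Qed.

Lemma polyfun_prod (I : Type) (r : seq I) (P : pred I) (h : I -> 'M[K]_(s, n.+1) -> K) :
  (forall i, polyfun (h i)) -> polyfun (fun p => \prod_(i <- r | P i) h i p).
Proof.
move=> H; elim: r => [|i r IH].
  by apply: eq_polyfun (polyfunC 1) => p; rewrite big_nil.
case: (boolP (P i)) => Pi.
  by apply: eq_polyfun (polyfunM (H i) IH) => p; rewrite big_cons Pi.
by apply: eq_polyfun IH => p; rewrite big_cons (negbTE Pi).
Qed.

Lemma polyfunX h k : polyfun h -> polyfun (fun p => h p ^+ k).
Proof.
move=> H; apply: eq_polyfun (polyfun_prod (index_enum 'I_k) xpredT (fun=> H)) => p.
by rewrite prodr_const card_ord.
Qed.

Lemma polyfun_det m (M : 'M[K]_(s, n.+1) -> 'M[K]_m) :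
  (forall i j, polyfun (fun p => M p i j)) -> polyfun (fun p => \det (M p)).
Proof.
move=> H; apply: polyfun_sum => g; apply: polyfunM; first exact: polyfunC.
by apply: polyfun_prod => i; apply: H.
Qed.

Lemma polyfun_adj m (M : 'M[K]_(s, n.+1) -> 'M[K]_m) :
  (forall i j, polyfun (fun p => M p i j)) ->
  forall i j, polyfun (fun p => (\adj (M p)) i j).
Proof.
move=> H i j.
apply: (@eq_polyfun (fun p => (-1) ^+ (j + i) * \det (row' j (col' i (M p))))).
  by move=> p; rewrite mxE.
apply: polyfunM; first exact: polyfunC.
by apply: polyfun_det => k l; apply: eq_polyfun (H (lift j k) (lift i l)) => p; rewrite !mxE.
Qed.

Lemma polyfun_comp (F : {mpoly K[s * n.+1]}) (Phi : 'M[K]_(s, n.+1) -> 'M[K]_(s, n.+1)) :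
  (forall j l, polyfun (fun p => Phi p j l)) ->
  polyfun (fun p => F.@[fun k => mxvec (Phi p) 0 k]).
Proof.
move=> H; apply: eq_polyfun (fun p => esym (mevalE _ _)) _.
apply: polyfun_sum => a; apply: polyfunM; first exact: polyfunC.
apply: polyfun_prod => k; apply: polyfunX; case/mxvec_indexP: k => j l.
by apply: eq_polyfun (H j l) => p; rewrite mxvecE.
Qed.

Implicit Types (Q : 'M[K]_(s, n.+1) -> Prop).

(** A single configuration satisfying an open condition shows that the general
    one does. *)
Lemma general_polyfun h p0 Q : polyfun h -> h p0 != 0 ->
  (forall p, (forall j, row j p != 0) -> h p != 0 -> Q p) -> for_general_points Q.
Proof.
move=> [F HF] hp0 H; exists F => [|p p_nz Fp]; last by apply: H; rewrite ?HF.
by apply: contraNneq hp0 => e; rewrite HF e meval0.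
Qed.

Lemma generalT Q : (forall p, (forall j, row j p != 0) -> Q p) -> for_general_points Q.
Proof. by move=> H; exists 1 => [|p p_nz _]; [apply: oner_neq0|apply: H]. Qed.

Lemma general_and Q Q' : for_general_points Q -> for_general_points Q' ->
  for_general_points (fun p => Q p /\ Q' p).
Proof.
move=> [F F0 HF] [G G0 HG]; exists (F * G); first by rewrite mulf_neq0.
move=> p p_nz; rewrite mevalM mulf_eq0 negb_or => /andP[Fp Gp].
by split; [apply: HF|apply: HG].
Qed.

Lemma general_mono Q Q' : (forall p, (forall j, row j p != 0) -> Q p -> Q' p) ->
  for_general_points Q -> for_general_points Q'.
Proof. by move=> H [F F0 HF]; exists F => // p p_nz Fp; apply: H => //; apply: HF. Qed.

Lemma general_forall (I : finType) (Q : I -> 'M[K]_(s, n.+1) -> Prop) :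
  (forall i, for_general_points (Q i)) ->
  for_general_points (fun p => forall i, Q i p).
Proof.
move=> H; have {H} : for_general_points (fun p => forall i, i \in enum I -> Q i p).
  elim: (enum I) => [|i r IH]; first exact: generalT.
  apply: general_mono (general_and (H i) IH) => p _ [Qi Qr] j.
  by rewrite inE => /predU1P[-> //|]; apply: Qr.
by apply: general_mono => p _ Hp i; apply: Hp; rewrite mem_enum.
Qed.
End PolynomialFunctions.

(** * The Cremona transformation of a configuration of points

    The base points of the Cremona transformation are kept in place instead of
    being moved to the coordinate points: the image of a general configuration
    would otherwise never be general. *)

Section Frames.
Variables (K : fieldType) (n s : nat) (o : 'I_n.+1 -> option 'I_s).
Implicit Types (p q : 'M[K]_(s, n.+1)).

(** Cremona transformations need n+1 points of the configuration, hyperplanes at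
    most n: unit vectors complete the latter to a basis. *)
Definition frame p : 'M[K]_n.+1 :=
  \matrix_(i, l) if o i is Some k then p k l else (i == l)%:R.

Definition framed k := [exists i, o i == Some k].

(** Coordinates of the k-th point in the frame, up to the factor det. *)
Definition coords p k : 'rV[K]_n.+1 := row k p *m \adj (frame p).

Definition good_frame p := (\det (frame p) != 0) &&
  [forall k, ~~ framed k ==> [forall i, coords p k 0 i != 0]].

Lemma good_frameP p : reflect
  (frame p \in unitmx /\ forall k, ~~ framed k -> forall i, coords p k 0 i != 0)
  (good_frame p).
Proof.
apply: (iffP andP); rewrite unitmxE unitfE => -[d H]; split=> //.
  by move=> k kf; move/forallP/(_ k)/implyP/(_ kf)/forallP: H.
by apply/forallP => k; apply/implyP => /H/forallP.
Qed.

Lemma row_frame p i k : o i = Some k -> row i (frame p) = row k p.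
Proof. by move=> e; apply/rowP => l; rewrite !mxE e. Qed.

Definition frame_poly p := \det (frame p) *
  \prod_(k | ~~ framed k) \prod_i coords p k 0 i.

Lemma frame_polyE p : (frame_poly p != 0) = good_frame p.
Proof.
rewrite /frame_poly mulf_eq0 negb_or; congr (_ && _).
apply/prodf_neq0/forallP => [H k|H k kf].
  by apply/implyP => kf; apply/forallP => i; move/prodf_neq0: (H k kf) => /(_ i); apply.
by apply/prodf_neq0 => i _; move/implyP/(_ kf)/forallP: (H k).
Qed.

Lemma polyfun_frame i l : polyfun (fun p => frame p i l).
Proof.
case e: (o i) => [k|].
  by apply: eq_polyfun (polyfun_entry K k l) => p; rewrite mxE e.
by apply: eq_polyfun (polyfunC _ _ (i == l)%:R) => p; rewrite mxE e.
Qed.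

Lemma polyfun_coords k i : polyfun (fun p => coords p k 0 i).
Proof.
apply: (@eq_polyfun _ _ _ (fun p => \sum_l p k l * (\adj (frame p)) l i)).
  by move=> p; rewrite [RHS]mxE; apply: eq_bigr => l _; rewrite [X in _ = X * _]mxE.
apply: polyfun_sum => l; apply: polyfunM; first exact: polyfun_entry.
exact: polyfun_adj polyfun_frame l i.
Qed.

Lemma polyfun_frame_poly : polyfun frame_poly.
Proof.
apply: polyfunM; first exact: polyfun_det polyfun_frame.
by apply: polyfun_prod => k; apply: polyfun_prod => i; apply: polyfun_coords.
Qed.

Hypothesis o_inj : forall i i' k, o i = Some k -> o i' = Some k -> i = i'.

Definition std_points : 'M[K]_(s, n.+1) :=
  \matrix_(k, l) if framed k then (o l == Some k)%:R else 1.

Lemma std_points_good : good_frame std_points.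
Proof.
have fr : frame std_points = 1%:M.
  apply/matrixP => i l; rewrite !mxE; case e: (o i) => [k|] //.
  have fk : framed k by apply/existsP; exists i; rewrite e.
  rewrite mxE fk; congr (_%:R); congr nat_of_bool.
  apply/eqP/eqP => [/o_inj|<-] //; by move/(_ _ e) ->.
have ad : \adj (1%:M : 'M[K]_n.+1) = 1%:M.
  by have := mul_mx_adj (1%:M : 'M[K]_n.+1); rewrite mul1mx det1.
apply/good_frameP; rewrite /coords fr unitmx1; split=> // k kf i.
by rewrite ad mulmx1 !mxE (negbTE kf) oner_neq0.
Qed.

Lemma general_frame : for_general_points good_frame.
Proof.
apply: (general_polyfun polyfun_frame_poly (p0 := std_points)).
  by rewrite frame_polyE std_points_good.
by move=> p _; rewrite frame_polyE.
Qed.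
End Frames.

Section CremonaPoints.
Variables (K : fieldType) (n s : nat) (f : 'I_n.+1 -> 'I_s).
Hypothesis f_inj : injective f.
Implicit Types (p q : 'M[K]_(s, n.+1)) (y : 'rV[K]_n.+1).

Notation frame := (frame (Some \o f)).
Notation coords := (coords (Some \o f)).
Notation cremona_good := (good_frame (Some \o f)).

Lemma framed_codom k : framed (Some \o f) k = (k \in codom f).
Proof.
apply/existsP/codomP => [[i /eqP[<-]]|[i ->]]; exists i => //=.
Qed.

Lemma cremona_goodP p : reflect
  (frame p \in unitmx /\ forall k, k \notin codom f -> forall i, coords p k 0 i != 0)
  (cremona_good p).
Proof.
apply: (iffP (good_frameP _ _)) => -[u H]; split=> // k kf;
  by apply: H; rewrite framed_codom in kf *.
Qed.

Definition std_cremona y : 'rV[K]_n.+1 := \row_i \prod_(l | l != i) y 0 l.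

Definition cremona_points p : 'M[K]_(s, n.+1) := \matrix_(k, l)
  if k \in codom f then p k l else (std_cremona (coords p k) *m frame p) 0 l.

Lemma frame_cremona p : frame (cremona_points p) = frame p.
Proof. by apply/matrixP => i l; rewrite !mxE /= mxE codom_f. Qed.

Lemma row_cremona_out p k : k \notin codom f ->
  row k (cremona_points p) = std_cremona (coords p k) *m frame p.
Proof. by move=> /negbTE kf; apply/rowP => l; rewrite 2![in LHS]mxE kf. Qed.

Lemma std_cremona_nz y i : (forall l, y 0 l != 0) -> std_cremona y 0 i != 0.
Proof. by move=> H; rewrite mxE; apply/prodf_neq0. Qed.

Lemma std_cremonaE y i : (forall l, y 0 l != 0) ->
  std_cremona y 0 i = (\prod_l y 0 l) / y 0 i.
Proof. by move=> H; rewrite mxE [in RHS](bigD1 i) //= mulrAC mulfV // mul1r. Qed.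

Lemma std_cremonaZ c y : std_cremona (c *: y) = c ^+ n *: std_cremona y.
Proof.
apply/rowP => i; rewrite !mxE; under eq_bigr do rewrite mxE.
rewrite big_split /= prodr_const; congr (c ^+ _ * _).
by rewrite -[n]/(n.+1.-1) -[in RHS](card_ord n.+1) -(cardC1 i); apply: eq_card => l.
Qed.

(** The standard Cremona map is an involution of projective space. *)
Lemma std_cremonaK y : (forall l, y 0 l != 0) ->
  exists2 d, d != 0 & std_cremona (std_cremona y) = d *: y.
Proof.
move=> H; set P := \prod_l y 0 l; have P0 : P != 0 by apply/prodf_neq0.
exists (P ^+ n.+1 / P / P) => [|]; first by rewrite !mulf_neq0 ?expf_neq0 ?invr_eq0.
apply/rowP => i; rewrite std_cremonaE; last by move=> l; apply: std_cremona_nz.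
rewrite (eq_bigr (fun l => P / y 0 l)) => [|l _]; last by rewrite std_cremonaE.
rewrite std_cremonaE // -/P big_split /= prodr_const card_ord prodfV -/P mxE.
by rewrite invfM invrK mulrA.
Qed.

(** In the coordinates given by the frame this is the standard Cremona
    transformation. *)
Lemma maps_cremona p : cremona_good p ->
  maps_primes p (cremona_points p) (cremona f) /\
  maps_primes (cremona_points p) p (cremona f).
Proof.
move=> /cremona_goodP[uA nz]; set q := cremona_points p; set A := frame p in uA *.
have detA : \det A != 0 by rewrite -unitfE -unitmxE.
have uAi : invmx A \in unitmx by rewrite unitmx_inv.
set p1 := p *m invmx A; set q1 := q *m invmx A.
have pE : p1 *m A = p by rewrite mulmxKV.
have qE : q1 *m A = q by rewrite mulmxKV.
have coord r : frame r = A -> coord_points f (r *m invmx A).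
  by move=> e i; rewrite row_mul -(@row_frame _ _ _ (Some \o f) r i) // e -row_mul mulmxV // row1.
have Hp : coord_points f p1 by apply: coord.
have Hq : coord_points f q1 by apply: coord; rewrite frame_cremona.
have pq : inverse_points f p1 q1.
  move=> k kf; exists ((\det A)^-1 * \prod_l coords p k 0 l).
    rewrite mulf_neq0 ?invr_eq0 //; apply/prodf_neq0 => l _; exact: nz.
  move=> i; have -> : q1 k i = std_cremona (coords p k) 0 i.
    have -> : q1 k i = (row k q1) 0 i by rewrite [RHS]mxE.
    by rewrite row_mul row_cremona_out // mulmxK.
  have -> : p1 k i = (\det A)^-1 * coords p k 0 i.
    have -> : p1 k i = (row k p1) 0 i by rewrite [RHS]mxE.
    by rewrite row_mul /invmx uA -scalemxAr mxE.
  rewrite -mulrA; congr (_ * _); rewrite std_cremonaE; last exact: nz.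
  by rewrite mulrC divfK ?nz.
have step (r : 'M[K]_(s, n.+1)) : maps_primes r (r *m invmx A) id := maps_linear r uAi.
have step' (r : 'M[K]_(s, n.+1)) : maps_primes (r *m invmx A) r id.
  by have := maps_linear (r *m invmx A) uA; rewrite mulmxKV.
split.
  exact: maps_primes_comp (maps_primes_comp (step p)
    (maps_standard_cremona f_inj Hp Hq pq)) (step' q).
exact: maps_primes_comp (maps_primes_comp (step q)
  (maps_standard_cremona f_inj Hq Hp (inverse_pointsC pq))) (step' p).
Qed.

Lemma effective_cremona p D : cremona_good p ->
  effective p D <-> effective (cremona_points p) (cremona f D).
Proof.
move=> /maps_cremona[H H']; split=> HD.
  exact: maps_effective (cremonaD f) (cremona0 f) H HD.
rewrite -[D](cremonaK f_inj); exact: maps_effective (cremonaD f) (cremona0 f) H' HD.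
Qed.

Lemma effective_irreducible_cremona p D : cremona_good p ->
  effective_irreducible p D <-> effective_irreducible (cremona_points p) (cremona f D).
Proof.
move=> /maps_cremona[H H']; split=> HD.
  exact: maps_irreducible (cremonaMn f) H HD.
rewrite -[D](cremonaK f_inj); exact: maps_irreducible (cremonaMn f) H' HD.
Qed.

Lemma row_cremona_nz p : cremona_good p -> (forall j, row j p != 0) ->
  forall j, row j (cremona_points p) != 0.
Proof.
move=> /cremona_goodP[uA nz] p0 k; have [kf|kf] := boolP (k \in codom f).
  have -> // : row k (cremona_points p) = row k p.
  by apply/rowP => l; rewrite !mxE kf.
rewrite row_cremona_out //; apply: contraTneq (std_cremona_nz ord0 (nz k kf)).
move=> /(congr1 (mulmx^~ (invmx (frame p)))); rewrite mulmxK // mul0mx => ->.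
by rewrite mxE eqxx.
Qed.

Lemma polyfun_cremona k l : polyfun (fun p => cremona_points p k l).
Proof.
have [kf|kf] := boolP (k \in codom f).
  by apply: eq_polyfun (polyfun_entry K k l) => p; rewrite mxE kf.
apply: (@eq_polyfun _ _ _ (fun p =>
  \sum_i (\prod_(j | j != i) coords p k 0 j) * frame p i l)).
  move=> p; rewrite [RHS]mxE (negbTE kf) mxE; apply: eq_bigr => i _.
  by rewrite [in RHS]mxE.
apply: polyfun_sum => i; apply: polyfunM; last exact: polyfun_frame.
by apply: polyfun_prod => j; apply: polyfun_coords.
Qed.

End CremonaPoints.

(** Up to rescaling the points, which costs the extraction of roots, the
    configuration can be recovered by applying the transformation twice. *)
Lemma cremona_points_surj (K : closedFieldType) (n s : nat) (f : 'I_n.+1 -> 'I_s)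
    (q : 'M[K]_(s, n.+1)) : (0 < n)%N -> good_frame (Some \o f) q ->
  exists2 p, good_frame (Some \o f) p & cremona_points f p = q.
Proof.
move=> n0 /cremona_goodP[uA nz]; set A := frame (Some \o f) q in uA *.
have detA : \det A != 0 by rewrite -unitfE -unitmxE.
have [t Ht] : exists t : 'I_s -> K, forall k, k \notin codom f -> t k != 0 /\
    std_cremona ((t k * \det A) *: std_cremona (coords (Some \o f) q k)) *m A = row k q.
  apply: (@fin_all_exists _ _ (fun k t => k \notin codom f -> t != 0 /\
    std_cremona ((t * \det A) *: std_cremona (coords (Some \o f) q k)) *m A = row k q)) => k.
  case: (boolP (k \in codom f)) => kf; first by exists 1.
  have [d d0 e] := std_cremonaK (nz k kf).
  have [t tn] := closed_nth_root ((\det A ^+ n * d * \det A)^-1) n0.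
  have c0 : \det A ^+ n * d * \det A != 0 by rewrite !mulf_neq0 ?expf_neq0.
  exists t => _; split.
    by apply/eqP => t0; have /eqP := tn;
      rewrite t0 expr0n (gtn_eqF n0) eq_sym invr_eq0 (negbTE c0).
  rewrite std_cremonaZ e -!scalemxAl /coords -mulmxA mul_adj_mx -/A.
  rewrite mul_mx_scalar !scalerA exprMn tn -[X in X *: _](_ : 1 = _) ?scale1r //.
  rewrite -[LHS](mulVf c0); ring.
pose p : 'M[K]_(s, n.+1) := \matrix_(k, l)
  if k \in codom f then q k l else t k * cremona_points f q k l.
have fp : frame (Some \o f) p = A by apply/matrixP => i l; rewrite !mxE /= mxE codom_f.
have cp k : k \notin codom f ->
    coords (Some \o f) p k = (t k * \det A) *: std_cremona (coords (Some \o f) q k).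
  move=> kf; rewrite /coords fp.
  have -> : row k p = t k *: (std_cremona (coords (Some \o f) q k) *m A).
    rewrite -row_cremona_out //; apply/rowP => l.
    by rewrite !mxE (negbTE kf).
  by rewrite -scalemxAl -mulmxA mul_mx_adj mul_mx_scalar scalerA.
exists p.
  apply/cremona_goodP; rewrite fp; split=> // k kf i.
  by rewrite cp // mxE !mulf_neq0 ?(Ht k kf).1 //; apply: std_cremona_nz => l; apply: nz.
apply/row_matrixP => k; have [kf|kf] := boolP (k \in codom f).
  by apply/rowP => l; rewrite !mxE kf.
by rewrite row_cremona_out // fp cp //; case: (Ht k kf).
Qed.

(** The transformation of configurations is given by polynomials and reaches every
    good configuration, so a nonzero polynomial stays nonzero when composed
    with it. *)
Lemma general_cremona (K : closedFieldType) (n s : nat) (f : 'I_n.+1 -> 'I_s)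
    (Q : 'M[K]_(s, n.+1) -> Prop) : (0 < n)%N -> injective f ->
  for_general_points Q ->
  for_general_points (fun p => good_frame (Some \o f) p /\ Q (cremona_points f p)).
Proof.
move=> n0 f_inj [F F0 HF]; have [G HG] := polyfun_frame_poly K (Some \o f).
have o_inj i i' k : (Some \o f) i = Some k -> (Some \o f) i' = Some k -> i = i'.
  by move=> /= [<-] [/f_inj ->].
have G0 : G != 0.
  apply: contraTneq (std_points_good K o_inj) => e.
  by rewrite -frame_polyE HG e meval0 eqxx.
have [v] : exists v, (F * G).@[v] != 0 by apply: mpoly_nonzero_eval; rewrite mulf_neq0.
pose q : 'M[K]_(s, n.+1) := vec_mx (\row_k v k).
have vq R : R.@[v] = R.@[fun k => mxvec q 0 k].
  by apply: meval_eq => k; rewrite vec_mxK mxE.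
rewrite mevalM mulf_eq0 negb_or !vq -HG frame_polyE => /andP[Fq gq].
have [p gp pq] := cremona_points_surj n0 gq.
apply: (general_polyfun (polyfunM (polyfun_frame_poly K (Some \o f))
   (polyfun_comp F (polyfun_cremona K f))) (p0 := p)).
  by rewrite mulf_neq0 // ?frame_polyE // pq.
move=> p' p'0; rewrite mulf_eq0 negb_or frame_polyE => /andP[gp' Fp'].
split=> //; apply: HF => // j; exact: row_cremona_nz.
Qed.

(** * Noether's inequality *)

Lemma exists_top_subset (s k : nat) (m : 'I_s -> int) : (k <= s)%N ->
  exists2 J : {set 'I_s}, #|J| = k &
    forall j l, j \in J -> l \notin J -> m l <= m j.
Proof.
elim: k => [|k IH] ks.
  by exists set0 => [|j l]; rewrite ?cards0 // inE.
have [J cJ HJ] := IH (ltnW ks).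
have [j0 j0J] : exists j0, j0 \notin J.
  have [j0] : exists j0, j0 \in ~: J.
    by apply/set0Pn; rewrite -card_gt0 cardsCs setCK card_ord cJ subn_gt0.
  by rewrite inE; exists j0.
have [j jJ Hj] := @Order.TotalTheory.arg_maxP _ int _ j0 (fun l => l \notin J) m j0J.
exists (j |: J) => [|x l]; first by rewrite cardsU1 jJ cJ.
rewrite !inE negb_or => /orP[/eqP ->|xJ] /andP[lj lJ]; last exact: HJ.
exact: Hj.
Qed.

Lemma exists_enumeration (s k : nat) (J : {set 'I_s}) : #|J| = k ->
  exists f : 'I_k -> 'I_s, [/\ injective f, forall i, f i \in J &
    forall F : 'I_s -> int, \sum_i F (f i) = \sum_(j in J) F j].
Proof.
move=> <-; exists (fun i => enum_val i); split=> [|i|F].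
- exact: enum_val_inj.
- exact: enum_valP.
- by rewrite [RHS]big_enum_val.
Qed.

Section Noether.
Variables (n s : nat) (i d : int) (m : 'I_s -> int).
Hypotheses (hi : i \in [:: -1; 0; 1]).
Hypotheses (N1 : (n%:Z - 1) * d ^+ 2 - \sum_(j < s) m j ^+ 2 = i)
           (N2 : (n%:Z + 1) * d - \sum_(j < s) m j = 2 + i).

Lemma sum_supp (T : {set 'I_s}) (F : 'I_s -> int) :
  (forall j, j \notin T -> F j = 0) -> \sum_j F j = \sum_(j in T) F j.
Proof.
move=> H; rewrite (bigID (fun j => j \in T)) /= [X in _ + X]big1 ?addr0 //.
Qed.

(** With at most n nonzero multiplicities, sum_T (d - m_j)^2 >= 0 becomes
    -3 d^2 + (4 + 2i) d - i >= 0. *)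
Lemma support_small_deg (T : {set 'I_s}) : (#|T| <= n)%N ->
  (forall j, j \notin T -> m j = 0) -> d <= 1.
Proof.
move=> cT HT; have sq0 : 0 <= \sum_(j in T) (d - m j) ^+ 2.
  by apply: sumr_ge0 => j _; apply: sqr_ge0.
have e : \sum_(j in T) (d - m j) ^+ 2 = #|T|%:Z * d ^+ 2
    - 2 * d * (\sum_j m j) + \sum_j m j ^+ 2.
  rewrite (sum_supp (F := m) HT) (sum_supp (T := T) (F := fun j => m j ^+ 2)); last first.
    by move=> j /HT ->.
  rewrite (eq_bigr (fun j => d ^+ 2 - 2 * d * m j + m j ^+ 2)) => [|j _]; last by ring.
  rewrite big_split sumrB /= sumr_const -[_ *+ #|T|]mulr_natl natz.
  by rewrite -[\sum_(j in T) 2 * d * m j]mulr_sumr.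
rewrite leNgt; apply/negP => d2.
move: e sq0; have -> : \sum_j m j = (n%:Z + 1) * d - (2 + i) by rewrite -N2; ring.
have -> : \sum_j m j ^+ 2 = (n%:Z - 1) * d ^+ 2 - i by rewrite -N1; ring.
move=> -> H.
have cT' : #|T|%:Z * d ^+ 2 <= n%:Z * d ^+ 2.
  by apply: ler_wpM2r; rewrite ?sqr_ge0 // lez_nat.
have : 0 <= - 3 * d ^+ 2 + (4 + 2 * i) * d - i.
  by apply: le_trans H _; rewrite -subr_ge0; move: cT'; rewrite -subr_ge0; congr (0 <= _); ring.
move: hi; rewrite !inE => /or3P[] /eqP ->; nia.
Qed.

(** Let J index the n+1 largest multiplicities and let a be their minimum. If
    their sum were at most (n-1)d, adding the inequalities
    (d - m_j)(m_j - a) >= 0 for j in J and m_j (a - m_j) >= 0 for j outside J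
    would give a (2 + i) <= i. This forces a = 0 and i >= 0, so that at most n
    multiplicities are nonzero, which bounds the degree by 1. *)
Lemma noether : (n < s)%N -> (forall j, 0 <= m j <= d) -> (i = -1 \/ 2 <= d) ->
  exists2 f : 'I_n.+1 -> 'I_s, injective f & (n%:Z - 1) * d < \sum_l m (f l).
Proof.
move=> ns md di.
have [J cJ HJ] := exists_top_subset m ns.
have [f [f_inj fJ Ef]] := exists_enumeration cJ.
exists f => //; rewrite Ef ltNge; apply/negP => le.
have [j0 j0J Hj0] := @Order.TotalTheory.arg_minP _ int _ (f ord0) (fun l => l \in J) m (fJ ord0).
set a := m j0.
have out l : l \notin J -> m l <= a by move=> lJ; apply: HJ.
have pos1 : 0 <= \sum_(j in J) (d - m j) * (m j - a).
  apply: sumr_ge0 => j jJ; have /andP[_ ?] := md j.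
  by rewrite mulr_ge0 // subr_ge0 // Hj0.
have pos2 : 0 <= \sum_(j in ~: J) m j * (a - m j).
  apply: sumr_ge0 => j; rewrite inE => jJ; have /andP[? _] := md j.
  by rewrite mulr_ge0 // subr_ge0 out.
have split (F : 'I_s -> int) : \sum_j F j = \sum_(j in J) F j + \sum_(j in ~: J) F j.
  by rewrite (bigID (fun j => j \in J)) /=; congr (_ + _); apply: eq_bigl => j; rewrite inE.
have key : \sum_(j in J) (d - m j) * (m j - a) + \sum_(j in ~: J) m j * (a - m j)
   = a * (\sum_j m j) - \sum_j m j ^+ 2 + d * (\sum_(j in J) m j) - (n%:Z + 1) * d * a.
  rewrite !split.
  rewrite (eq_bigr (fun j => (d + a) * m j - m j ^+ 2 - d * a)) => [|j _]; last by ring.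
  rewrite [X in _ + X](eq_bigr (fun j => a * m j - m j ^+ 2)) => [|j _]; last by ring.
  rewrite !sumrB sumr_const cJ -[_ *+ n.+1]mulr_natl natz -[n.+1]addn1 PoszD.
  rewrite -[\sum_(j in J) (d + a) * m j]mulr_sumr -[\sum_(j in ~: J) a * m j]mulr_sumr.
  by ring.
have aN : 0 <= - a * (2 + i) + i.
  apply: le_trans (_ : 0 <= a * (\sum_j m j) - \sum_j m j ^+ 2
     + d * (\sum_(j in J) m j) - (n%:Z + 1) * d * a) _.
    by rewrite -key addr_ge0.
  have -> : \sum_j m j = (n%:Z + 1) * d - (2 + i) by rewrite -N2; ring.
  have -> : \sum_j m j ^+ 2 = (n%:Z - 1) * d ^+ 2 - i by rewrite -N1; ring.
  have d0 : 0 <= d by have /andP[] := md j0; apply: le_trans.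
  have h := ler_wpM2l d0 le; rewrite -subr_ge0 in h.
  by rewrite -subr_ge0; apply: le_trans h _; rewrite le_eqVlt; apply/orP; left; apply/eqP; ring.
have a0 : 0 <= a by have /andP[] := md j0.
have [i1|i1] := eqVneq i (-1); first by move: aN; rewrite i1; lia.
have d2 : 2 <= d by case: di => // e; rewrite e eqxx in i1.
have az : a = 0.
  by move: i1 aN; have := hi; rewrite !inE => /or3P[] /eqP -> //; lia.
have cT : (#|J :\ j0| <= n)%N by have := cardsD1 j0 J; rewrite j0J cJ add1n => -[->].
have := support_small_deg cT; have out0 j : j \notin J :\ j0 -> m j = 0.
  rewrite !inE negb_and negbK => /orP[/eqP -> //|/out].
  by rewrite az => le0; apply/eqP; rewrite eq_le le0; have /andP[] := md j.
by move=> /(_ out0); lia.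
Qed.
End Noether.

(** ** Classes of degree at most 1 *)

Section SmallDegree.
Variables (n s : nat).
Implicit Types (D : Pic s).

Lemma sum_sqr_eq0 (I : finType) (P : pred I) (F : I -> int) :
  \sum_(j | P j) F j ^+ 2 <= 0 -> forall j, P j -> F j = 0.
Proof.
move=> H j Pj; have H0 : \sum_(j | P j) F j ^+ 2 = 0.
  by apply/eqP; rewrite eq_le H sumr_ge0 // => l _; apply: sqr_ge0.
have /(_ j Pj)/eqP := psumr_eq0P (fun l _ => sqr_ge0 (F l)) H0.
by rewrite sqrf_eq0 => /eqP.
Qed.

Lemma pairing_sqr D :
  pairing n D D = (n%:Z - 1) * deg D ^+ 2 - \sum_j mlt D j ^+ 2.
Proof. by rewrite /pairing expr2 mulrA; congr (_ - _); apply: eq_bigr => j _; rewrite expr2. Qed.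

Lemma deg0_class i D : i \in [:: -1; 0; 1] -> pairing n D D = i ->
  adeg n D = 2 + i -> deg D = 0 -> i = -1 /\ exists j, D = Ecl j.
Proof.
move=> hi; rewrite pairing_sqr /adeg => N1 N2 d0.
rewrite d0 expr0n mulr0 sub0r in N1; rewrite d0 mulr0 sub0r in N2.
have [j mj] : exists j, mlt D j != 0.
  apply/existsP; apply: contraPT N2; rewrite negb_exists => /forallP H.
  rewrite big1 => [|j _]; last by apply/eqP; rewrite -[_ == _]negbK.
  by move: hi; rewrite !inE => /or3P[] /eqP ->.
have N1' : mlt D j ^+ 2 + \sum_(l | l != j) mlt D l ^+ 2 = - i.
  by rewrite -N1 opprK [RHS](bigD1 j).
have m1 : 1 <= mlt D j ^+ 2 by rewrite -gtz0_ge1 lt_neqAle eq_sym sqrf_eq0 mj sqr_ge0.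
have pj : 0 <= \sum_(l | l != j) mlt D l ^+ 2 by apply: sumr_ge0 => l _; apply: sqr_ge0.
have i1 : i = -1.
  by move: hi; rewrite !inE => /or3P[] /eqP e //; rewrite e in N1'; lia.
split=> //; exists j.
have le0 : \sum_(l | l != j) mlt D l ^+ 2 <= 0 by lia.
have out l : l != j -> mlt D l = 0 := sum_sqr_eq0 le0 (j := l).
move: N2; rewrite (bigD1 j) //= big1 => [|l /out //]; rewrite addr0 i1 => N2.
apply: Pic_eq => // l; rewrite mltE; have [->|/out //] := eqVneq l j.
by move: N2; lia.
Qed.

(** In degree 1 the two conditions give sum_j m_j (m_j - 1) = 0, where every term
    is nonnegative because the m_j are integers. *)
Lemma deg1_class i D : pairing n D D = i -> adeg n D = 2 + i -> deg D = 1 ->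
  (forall j, mlt D j = (mlt D j == 1)%:R) /\
  #|[set j | mlt D j == 1]|%:Z = n%:Z - 1 - i.
Proof.
rewrite pairing_sqr /adeg => N1 N2 d1.
rewrite d1 expr1n mulr1 in N1; rewrite d1 mulr1 in N2.
have S2 : \sum_j mlt D j ^+ 2 = n%:Z - 1 - i by rewrite -N1; ring.
have S1 : \sum_j mlt D j = n%:Z - 1 - i.
  by transitivity (n%:Z + 1 - (2 + i)); [rewrite -N2|]; ring.
have nn (x : int) : 0 <= x ^+ 2 - x by nia.
have m01 j : mlt D j = (mlt D j == 1)%:R.
  have H0 : \sum_j (mlt D j ^+ 2 - mlt D j) = 0 by rewrite sumrB S1 S2 subrr.
  have /(_ j isT) e := psumr_eq0P (fun l _ => nn (mlt D l)) H0.
  have /orP : (mlt D j == 0) || (mlt D j == 1).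
    by rewrite -[X in _ || X]subr_eq0 -mulf_eq0 mulrBr mulr1 -expr2 e.
  by case=> /eqP ->.
split=> //; rewrite -S1.
rewrite (eq_bigr _ (fun j _ => m01 j)) -natr_sum -sum1dep_card natz.
congr (Posz _); rewrite [LHS]big_mkcond /=; apply: eq_bigr => j _; by case: eqP.
Qed.
End SmallDegree.

(** * Effective classes and hyperplanes *)

Section Effective.
Variables (K : fieldType) (n s : nat) (p : 'M[K]_(s, n.+1)).
Implicit Types (D E : Pic s) (P : prime_divisor K n s).

Lemma prime_deg_ge0 P : 0 <= deg (prime_class p P).
Proof. by case: P. Qed.

Lemma prime_mlt_le_deg P j : mlt (prime_class p P) j <= deg (prime_class p P).
Proof.
case: P => [l|e G He Gi]; first by rewrite mltE deg_dclass oppr_le0.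
rewrite prime_class_strict mlt_dclass deg_dclass lez_nat.
by apply: mult_le_deg => //; case: Gi.
Qed.

Lemma divisor_class_cons P A :
  divisor_class p (P :: A) = prime_class p P + divisor_class p A.
Proof. by rewrite /divisor_class big_cons. Qed.

Lemma divisor_class_nil : divisor_class p ([::] : seq (prime_divisor K n s)) = 0.
Proof. by rewrite /divisor_class big_nil. Qed.

Lemma effective_deg_ge0 D : effective p D -> 0 <= deg D.
Proof.
move=> [A <-]; elim: A => [|P A IH]; first by rewrite divisor_class_nil.
by rewrite divisor_class_cons degD addr_ge0 // prime_deg_ge0.
Qed.

Lemma effective_mlt_le_deg D j : effective p D -> mlt D j <= deg D.
Proof.
move=> [A <-]; elim: A => [|P A IH]; first by rewrite divisor_class_nil mlt0.
by rewrite divisor_class_cons degD mltD lerD // prime_mlt_le_deg.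
Qed.

(** Only the exceptional divisor over the j-th point contributes negatively to the
    j-th multiplicity, so it must be a component. *)
Lemma effective_sub_exc D j : effective p D -> mlt D j < 0 -> effective p (D - Ecl j).
Proof.
move=> [A <-]; elim: A => [|P A IH]; first by rewrite divisor_class_nil mlt0.
rewrite divisor_class_cons mltD => lt.
have [ltA|geA] := ltP (mlt (divisor_class p A) j) 0.
  have [B eB] := IH ltA; exists (P :: B).
  by rewrite divisor_class_cons eB addrA.
have {lt geA} : mlt (prime_class p P) j < 0 by lia.
case: P => [l|e G He Gi]; last by rewrite prime_class_strict mlt_dclass.
rewrite mltE; case: eqP => [-> _|//]; exists A.
by rewrite addrC addrA addNr add0r.
Qed.

Lemma irreducible_effective D : effective_irreducible p D -> effective p D.
Proof. by move=> [A e _]; exists A. Qed.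

Lemma irreducible_exc j : effective_irreducible p (Ecl j).
Proof.
by apply/effective_irreducibleP; exists 0%N, (Exceptional _ _ j).
Qed.

Lemma irreducible_mlt_ge0 D j : effective_irreducible p D -> 0 < deg D -> 0 <= mlt D j.
Proof.
move=> /effective_irreducibleP[k [[l|e G He Gi] ->]].
  by rewrite degMn deg_dclass mul0rn.
by move=> _; rewrite mltMn prime_class_strict mlt_dclass mulrn_wge0.
Qed.

Lemma irreducible_exc_pairing D j : effective_irreducible p D ->
  0 <= mlt D j \/ exists k, D = Ecl j *+ k.
Proof.
move=> /effective_irreducibleP[k [[l|e G He Gi] ->]]; last first.
  by left; rewrite mltMn prime_class_strict mlt_dclass mulrn_wge0.
have [->|jl] := eqVneq j l; first by right; exists k.+1.
by left; rewrite mltMn mltE (negbTE jl) oppr0 mul0rn.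
Qed.
End Effective.

Section Hyperplanes.
Variables (K : fieldType) (n s : nat) (o : 'I_n.+1 -> option 'I_s).
Implicit Types (p : 'M[K]_(s, n.+1)).

(** Omitting the vector i0 from the frame leaves a basis of a hyperplane; it
    contains none of the points outside the frame. *)
Lemma hyperplane_class p i0 : o i0 = None -> good_frame o p ->
  effective_irreducible p (dclass 1 (fun k => (framed o k)%:R)).
Proof.
move=> oi0 /good_frameP[uA nz]; set A := frame o p in uA.
have detA : \det A != 0 by rewrite -unitfE -unitmxE.
pose G := linform (\adj A) i0.
have evG (v : 'rV[K]_n.+1) : G.@[v 0] = (v *m \adj A) 0 i0.
  by rewrite meval_linform mxE.
have G1 : G \is 1.-homog := linform_homog _ _.
have evA i : G.@[row i A 0] = (\det A) *+ (i == i0).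
  by rewrite evG -row_mul mul_mx_adj !mxE.
have G0 : G != 0.
  apply: contraNneq detA => e; have := evA i0; rewrite e meval0 eqxx mulr1n.
  by move=> <-.
apply/effective_irreducibleP; exists 0%N.
exists (StrictTransform s G1 (linear_irreducible G0 G1)).
rewrite mulr1n prime_class_strict; apply: Pic_eq => // k.
rewrite !mlt_dclass mult_linear //; case: (boolP (framed o k)) => [/existsP[i /eqP oi]|kf].
  have /negbTE ii0 : i != i0 by apply/eqP => e; rewrite e oi0 in oi.
  by rewrite -(row_frame p oi) evA ii0 mulr0n eqxx.
by rewrite evG (negbTE (nz k kf i0)).
Qed.
End Hyperplanes.

(** A hypersurface other than the hyperplane through n independent points
    restricts to a hypersurface of that hyperplane, whose equation involves a
    monomial; its multiplicity at the i-th point is at most the degree of this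
    monomial in the other variables. *)
Lemma hyperplane_pairing (K : fieldType) (n : nat) (p : 'M[K]_(n, n.+1)) (D' : Pic n) :
  good_frame (unlift ord_max) p -> deg D' = 1 -> (forall j, mlt D' j = 1) ->
  forall D, effective_irreducible p D ->
    0 <= pairing n D D' \/ exists k, D = D' *+ k.
Proof.
set o : 'I_n.+1 -> option 'I_n := unlift ord_max.
move=> /good_frameP[uA _] d1 m1 D /effective_irreducibleP[k [P ->]].
have uAi : invmx (frame o p) \in unitmx by rewrite unitmx_inv.
have [P' <-] := maps_linear p uAi P; set q := p *m _.
have Hq j : row j q = delta_mx 0 (lift ord_max j).
  have oj : o (lift ord_max j) = Some j by rewrite /o liftK.
  by rewrite row_mul -(row_frame p oj) -row_mul mulmxV // row1.
suff : 0 <= pairing n (prime_class q P') D' \/ prime_class q P' = D'.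
  by case=> [H|->]; [left; rewrite pairingMnl mulrn_wge0|right; exists k.+1].
case: P' => [j|e G He Gi]; first by left; rewrite pairingC pairingE m1.
have [G0 _ _] := Gi; rewrite prime_class_strict.
have [/hasP[a aG /eqP a0]|/(not_divN Gi)[c c0 eG]] := boolP (not_div ord_max G).
  left; rewrite /pairing d1 mulr1 deg_dclass.
  rewrite (eq_bigr (fun j => (mult (row j q) G)%:Z)) => [|j _]; last first.
    by rewrite m1 mulr1 mlt_dclass.
  have ea : \sum_j (a (lift ord_max j))%:Z = e%:Z.
    rewrite -(homog_mdeg He aG) mdegE (bigD1_ord ord_max) //= a0 add0n.
    by rewrite (big_morph Posz PoszD erefl).
  have le : \sum_j (mult (row j q) G)%:Z <= \sum_j (e%:Z - (a (lift ord_max j))%:Z).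
    apply: ler_sum => j _; rewrite lerBrDr addrC -PoszD lez_nat Hq.
    exact: ((vanishes_coord _ _ He).1 ((mult_geP _ _ G0).1 (leqnn _)) a aG).
  rewrite subr_ge0; apply: le_trans le _.
  by rewrite sumrB ea sumr_const card_ord -mulr_natl natz mulrBl mul1r.
right; have H1 : G \is 1.-homog by rewrite eG; apply: rpredZ; rewrite dhomogX /= mdeg1.
have e1 : e = 1%N := dhomog_uniq G0 He H1.
apply: Pic_eq => [|j]; first by rewrite deg_dclass d1 e1.
rewrite mlt_dclass m1 mult_linear // Hq eG mevalZ mevalXU mxE eqxx.
by rewrite (negbTE (neq_lift _ _)) mulr0 eqxx.
Qed.

(** * Reduction of the degree by Cremona transformations *)

Lemma general_hyperplane_pairing (K : fieldType) (n s : nat) (D' : Pic s) : s = n ->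
  deg D' = 1 -> (forall j, mlt D' j = 1) ->
  for_general_points (fun p : 'M[K]_(s, n.+1) =>
    forall D, effective_irreducible p D ->
      0 <= pairing n D D' \/ exists k, D = D' *+ k).
Proof.
move=> es; subst s => d1 m1.
have o_inj (i i' : 'I_n.+1) (k : 'I_n) :
    unlift ord_max i = Some k -> unlift ord_max i' = Some k -> i = i'.
  by case: unliftP => [j ->|//] [->]; case: unliftP => [j' ->|//] [->].
by apply: general_mono (general_frame K o_inj) => p _ gp; apply: hyperplane_pairing.
Qed.

Section Reduction.
Variables (K : closedFieldType) (n s : nat) (hn : (2 <= n)%N).
Implicit Types (D E : Pic s) (p : 'M[K]_(s, n.+1)).

Lemma noether_cremona i D : i \in [:: -1; 0; 1] -> pairing n D D = i ->
  adeg n D = 2 + i -> (n < s)%N -> (forall j, 0 <= mlt D j <= deg D) ->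
  (i = -1 \/ 2 <= deg D) ->
  exists2 f : 'I_n.+1 -> 'I_s, injective f & deg (cremona f D) < deg D.
Proof.
move=> hi; rewrite pairing_sqr => N1 N2 ns md di.
have [f f_inj lt] := noether hi N1 N2 ns md di.
by exists f; rewrite // deg_cremona pairing_root //; lia.
Qed.

(** Cremona transformations turn an irreducible (-1) class into an exceptional
    divisor, with which every other prime divisor has nonnegative pairing, a
    multiplicity. The statement allows multiples of D' instead of comparing
    degrees because degrees are not preserved by the transformations. *)
Lemma negative_class_pairing N D' : deg D' <= N%:Z ->
  pairing n D' D' = -1 -> adeg n D' = 2 + -1 ->
  for_general_points (fun p => effective_irreducible p D' ->
    forall D, effective_irreducible p D ->
      0 <= pairing n D D' \/ exists k, D = D' *+ k).
Proof.
elim: N D' => [|N IH] D' dN N1 N2.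
  have [d0|d0] := ltP (deg D') 0.
    by apply: generalT => p _ /irreducible_effective/effective_deg_ge0; lia.
  have d0' : deg D' = 0 by lia.
  have [_ [j ->]] := deg0_class (i := -1) isT N1 N2 d0'.
  by apply: generalT => p _ _ D /(irreducible_exc_pairing j); rewrite pairingE.
have [dN'|dN'] := leP (deg D') N%:Z; first exact: IH.
have dpos : 0 < deg D' by lia.
case: (boolP [forall j, 0 <= mlt D' j <= deg D']) => [/forallP md|]; last first.
  rewrite negb_forall => /existsP[j mj]; apply: generalT => p _ irr.
  case/negP: mj; rewrite (irreducible_mlt_ge0 j irr dpos).
  by rewrite (effective_mlt_le_deg j (irreducible_effective irr)).
(* On at most n points there is no Cremona transformation to apply, and D' can
   only be the hyperplane through all of exactly n points. *)
have [ns|sn] := ltnP n s.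
  have [f f_inj lt] := noether_cremona (i := -1) isT N1 N2 ns md (or_introl erefl).
  have {}IH : for_general_points _ := IH (cremona f D') _ _ _.
  have n0 : (0 < n)%N by lia.
  apply: general_mono (general_cremona n0 f_inj (IH _ _ _)); first last.
  - by rewrite adeg_cremona.
  - by rewrite pairing_cremona.
  - by lia.
  move=> p _ [gp H] irr D irrD.
  have /H{}H := (effective_irreducible_cremona f_inj D' gp).1 irr.
  have /H := (effective_irreducible_cremona f_inj D gp).1 irrD.
  rewrite pairing_cremona // => -[|[k e]]; first by left.
  by right; exists k; rewrite -[D](cremonaK f_inj) e cremonaMn cremonaK.
have d1 : deg D' = 1.
  have le1 : deg D' <= 1.
    rewrite pairing_sqr in N1.
    apply: (@support_small_deg n s (-1) _ (mlt D') isT N1 N2 setT).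
      by rewrite cardsT card_ord.
    by move=> j; rewrite inE.
  by lia.
have [_ cS] := deg1_class N1 N2 d1.
set S := [set j | mlt D' j == 1] in cS.
have cS' : #|S| = n by lia.
have sS := subset_leq_card (subsetT S); rewrite cardsT card_ord in sS.
have es : s = n by lia.
have ST : S = setT by apply/eqP; rewrite eqEcard subsetT cardsT card_ord cS' sn.
have m1 j : mlt D' j = 1 by have : j \in S by [rewrite ST inE|]; rewrite inE => /eqP.
apply: general_mono (general_hyperplane_pairing K es d1 m1) => p _ H _; exact: H.
Qed.

(** The multiplicities are 0 and 1, with n - 1 - i <= n ones; completing these
    points by unit vectors to n vectors gives a hyperplane through none of the
    other points. *)
Lemma general_hyperplane i D : i \in [:: -1; 0; 1] -> pairing n D D = i ->
  adeg n D = 2 + i -> deg D = 1 ->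
  for_general_points (fun p : 'M[K]_(s, n.+1) => effective_irreducible p D).
Proof.
move=> hi N1 N2 d1; have [m01 cS] := deg1_class N1 N2 d1.
set S := [set j | mlt D j == 1] in cS.
have cSn : (#|S| <= n)%N by move: hi cS; rewrite !inE => /or3P[] /eqP ->; lia.
pose o (l : 'I_n.+1) : option 'I_s := omap enum_val (insub (l : nat) : option 'I_#|S|).
have oP l k : o l = Some k -> exists2 x : 'I_#|S|, x = l :> nat & enum_val x = k.
  by rewrite /o; case: insubP => //= x _ e [<-]; exists x.
have o_inj l l' k : o l = Some k -> o l' = Some k -> l = l'.
  move=> /oP[x xl <-] /oP[x' x'l /enum_val_inj e].
  by apply/val_inj; rewrite /= -xl -x'l e.
have oN : o ord_max = None by rewrite /o insubF //= ltnNge cSn.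
have frS k : framed o k = (k \in S).
  apply/existsP/idP => [[l /eqP/oP[x _ <-]]|kS]; first exact: enum_valP.
  have xn : (enum_rank_in kS k < n.+1)%N by apply: leq_trans (ltn_ord _) (leqW cSn).
  exists (Ordinal xn); rewrite /o /= insubT //= => H.
  by apply/eqP; congr Some; rewrite (_ : Sub _ _ = enum_rank_in kS k) ?enum_rankK_in //; apply: val_inj.
apply: general_mono (general_frame K o_inj) => p _ gp.
have -> : D = dclass 1 (fun k => (framed o k)%:R); last exact: hyperplane_class oN gp.
apply: Pic_eq => [|k]; first by rewrite d1.
by rewrite mlt_dclass frS inE; apply: m01.
Qed.

(** The degree is reduced by Cremona transformations. Either all multiplicities
    stay nonnegative, down to a hyperplane or an exceptional divisor; or at some
    stage one of them is negative, and pulling back that exceptional divisor gives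
    a (-1) class that is a component of D. That it is a component is recorded
    because it bounds the degree of the (-1) class. *)
Lemma irreducible_or_negative i N D : i \in [:: -1; 0; 1] -> deg D <= N%:Z ->
  pairing n D D = i -> adeg n D = 2 + i ->
  for_general_points (fun p : 'M[K]_(s, n.+1) => effective p D ->
    effective_irreducible p D \/ exists D', [/\ divisorial_class p (-1) D',
      pairing n D D' < 0 & effective p (D - D')]).
Proof.
move=> hi; elim: N D => [|N IH] D dN N1 N2.
  have [d0|d0] := ltP (deg D) 0.
    by apply: generalT => p _ /effective_deg_ge0; lia.
  have d0' : deg D = 0 by lia.
  have [_ [j ->]] := deg0_class hi N1 N2 d0'.
  by apply: generalT => p _ _; left; apply: irreducible_exc.
have [dN'|dN'] := leP (deg D) N%:Z; first exact: IH.
have dpos : 0 < deg D by lia.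
case: (boolP [forall j, mlt D j <= deg D]) => [/forallP mled|]; last first.
  rewrite negb_forall => /existsP[j /negP mj]; apply: generalT => p _ eff.
  by case: mj; apply: effective_mlt_le_deg eff.
case: (boolP [forall j, 0 <= mlt D j]) => [/forallP m0|]; last first.
  rewrite negb_forall => /existsP[j]; rewrite -ltNge => mj.
  apply: generalT => p _ eff; right; exists (Ecl j); split.
  - split; first exact: irreducible_exc.
      by rewrite pairingE mltE eqxx.
    rewrite /adeg deg_dclass mulr0 sub0r (bigD1 j) //= big1 => [|l lj].
      by rewrite mltE eqxx.
    by rewrite mltE (negbTE lj) oppr0.
  - by rewrite pairingE.
  - exact: effective_sub_exc.
have md j : 0 <= mlt D j <= deg D by rewrite m0 mled.
have [d1|d1] := eqVneq (deg D) 1.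
  by apply: general_mono (general_hyperplane hi N1 N2 d1) => p _ irr _; left.
have d2 : 2 <= deg D by lia.
have ns : (n < s)%N.
  rewrite ltnNge; apply/negP => sn; rewrite pairing_sqr in N1.
  have : deg D <= 1; last by lia.
  apply: (@support_small_deg n s i _ (mlt D) hi N1 N2 setT).
    by rewrite cardsT card_ord.
  by move=> j; rewrite inE.
have [f f_inj lt] := noether_cremona hi N1 N2 ns md (or_intror d2).
have n0 : (0 < n)%N by lia.
have {}IH := IH (cremona f D) _ _ _.
apply: general_mono (general_cremona n0 f_inj (IH _ _ _)); first last.
- by rewrite adeg_cremona.
- by rewrite pairing_cremona.
- by lia.
move=> p _ [gp H] eff.
have /H[irr|[E [[irrE E1 E2] DE eDE]]] := (effective_cremona f_inj D gp).1 eff.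
  by left; apply/(effective_irreducible_cremona f_inj D gp).
right; exists (cremona f E); split.
- split; last by rewrite adeg_cremona.
    by apply/(effective_irreducible_cremona f_inj _ gp); rewrite cremonaK.
  by rewrite pairing_cremona.
- by rewrite -[D](cremonaK f_inj) pairing_cremona.
- by apply/(effective_cremona f_inj _ gp); rewrite cremonaD cremonaN cremonaK.
Qed.
End Reduction.

Theorem theorem0p10 (K : closedFieldType) (n s : nat) (hn : (2 <= n)%N)
    (i : int) (hi : i \in [:: -1; 0; 1])
    (d : int) (m : 'I_s -> int) (hm : 0 < d -> forall j, 0 <= m j) :
  for_general_points (fun p : 'M[K]_(s, n.+1) =>
    let D := Hcl s *~ d - \sum_(j < s) Ecl j *~ m j in
    divisorial_class p i D <->
    [/\ effective p D,
        (n%:Z - 1) * d ^+ 2 - \sum_(j < s) m j ^+ 2 = i,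
        (n%:Z + 1) * d - \sum_(j < s) m j = 2 + i
      & forall d' : int, 0 < d' -> d' < d ->
        forall D' : Pic s, divisorial_class p (-1) D' -> deg D' = d' ->
          0 <= pairing n D D']).
Proof.
rewrite -dclassE; set D := dclass d m.
have mD j : mlt D j = m j := mlt_dclass d m j.
have pDD : pairing n D D = (n%:Z - 1) * d ^+ 2 - \sum_(j < s) m j ^+ 2.
  rewrite pairing_sqr; congr (_ - _); by apply: eq_bigr => j _; rewrite mD.
have aD : adeg n D = (n%:Z + 1) * d - \sum_(j < s) m j.
  by rewrite /adeg; congr (_ - _); apply: eq_bigr => j _; rewrite mD.
rewrite -pDD -aD; clear pDD aD.
pose num (i : int) (E : Pic s) := (pairing n E E == i) && (adeg n E == 2 + i).
(* A general configuration only satisfies finitely many open conditions. The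
   multiplicities of an irreducible class lie between 0 and its degree, so
   finitely many D' of degree less than d need to be considered. *)
pose cand (c : 'I_`|d| * {ffun 'I_s -> 'I_`|d|.+1}) : Pic s :=
  dclass (c.1 : nat)%:Z (fun j => (c.2 j : nat)%:Z).
have gen1 : for_general_points (fun p : 'M[K]_(s, n.+1) =>
    forall c, num (-1) (cand c) -> effective_irreducible p (cand c) ->
    forall E, effective_irreducible p E ->
      0 <= pairing n E (cand c) \/ exists k, E = cand c *+ k).
  apply: general_forall => c; have [/andP[/eqP N1 /eqP N2]|_] := boolP (num (-1) (cand c)).
    have dle : deg (cand c) <= `|deg (cand c)|%:Z by lia.
    by apply: general_mono (negative_class_pairing K hn dle N1 N2) => p _ H _; apply: H.
  exact: generalT.
have gen2 : for_general_points (fun p : 'M[K]_(s, n.+1) => num i D -> effective p D ->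
    effective_irreducible p D \/ exists D', [/\ divisorial_class p (-1) D',
      pairing n D D' < 0 & effective p (D - D')]).
  have [/andP[/eqP N1 /eqP N2]|_] := boolP (num i D); last exact: generalT.
  have dle : deg D <= `|deg D|%:Z by lia.
  by apply: general_mono (irreducible_or_negative K hn hi dle N1 N2) => p _ H _.
apply: general_mono (general_and gen1 gen2) => p _ [H1 H2]; split.
  move=> [irr N1 N2]; split=> //; first exact: irreducible_effective.
  move=> d' d'0 d'd E [irrE E1 E2] dE.
  have [c cE] : exists c, cand c = E.
    have Emlt j : 0 <= mlt E j <= d'.
      rewrite (irreducible_mlt_ge0 j irrE) ?dE //= -dE.
      exact: effective_mlt_le_deg (irreducible_effective irrE).
    have lt1 : (`|d'| < `|d|)%N by lia.
    have lt2 j : (`|mlt E j| < `|d|.+1)%N by have := Emlt j; lia.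
    exists (Ordinal lt1, [ffun j => Ordinal (lt2 j)]).
    apply: Pic_eq => [|j]; first by rewrite deg_dclass dE /=; lia.
    by rewrite mlt_dclass /= ffunE /=; have := Emlt j; lia.
  have numc : num (-1) (cand c) by rewrite cE /num E1 E2 !eqxx.
  have := H1 c numc; rewrite cE => /(_ irrE D irr)[//|[k eD]].
  rewrite pmulrn in eD.
  have k1 : k%:Z = 2 + i by rewrite -N2 eD adegMz E2 mul1r.
  have k2 : pairing n D D = - (k%:Z * k%:Z).
    by rewrite eD pairingMzl pairingMzr E1 -mulrA mulN1r.
  have k3 : d = d' * k%:Z by rewrite -[d]/(deg D) eD degMz dE.
  move: k2 k3; rewrite k1 N1; move: hi; rewrite !inE => /or3P[] /eqP -> //.
  by move=> _ dd; move: d'd; rewrite dd mulr1 ltxx.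
move=> [eff N1 N2 nonneg].
have numD : num i D by rewrite /num N1 N2 !eqxx.
have [irr|[E [clE neg eDE]]] := H2 numD eff; first by split.
have [d0|d0] := ltP 0 d; last first.
  have d0' : deg D = 0 by have := effective_deg_ge0 eff; rewrite /D deg_dclass; lia.
  have [_ [l eD]] := deg0_class hi N1 N2 d0'.
  by split=> //; rewrite eD; apply: irreducible_exc.
have [irrE E1 E2] := clE.
have dE0 := effective_deg_ge0 (irreducible_effective irrE).
have dED := effective_deg_ge0 eDE; rewrite degD degN deg_dclass in dED.
have [dEz|dEnz] := eqVneq (deg E) 0.
  have [_ [j eE]] := deg0_class (i := -1) isT E1 E2 dEz.
  by move: neg; rewrite eE pairingE mD; have := hm d0 j; lia.
have [dEd|dEd] := ltP (deg E) d.
  have dE1 : 0 < deg E by lia.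
  by have := nonneg _ dE1 dEd E clE erefl; lia.
(* Now D - E is effective of degree 0, a sum of a_j E_j with a_j >= 0, and
   <D, E> = -1 + sum_j a_j (m_j + a_j) < 0 leaves only a = 0. *)
have dE : deg E = d by lia.
have mE j : m j <= mlt E j.
  by have := effective_mlt_le_deg j eDE; rewrite degD degN deg_dclass mltD mltN mD; lia.
have sq : \sum_j (mlt E j - m j) ^+ 2 <= 0.
  have le : \sum_j (mlt E j - m j) ^+ 2 <= \sum_j (mlt E j ^+ 2 - m j * mlt E j).
    by apply: ler_sum => j _; have := mE j; have := hm d0 j; nia.
  apply: le_trans le _; rewrite sumrB.
  move: E1 neg; rewrite pairing_sqr /pairing deg_dclass dE.
  under [\sum_(j < s) mlt D j * _]eq_bigr do rewrite mD.
  rewrite expr2 mulrA; move: (\sum_j _) (\sum_j _) (_ * d) => x y z.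
  by lia.
have eD : D = E.
  apply: Pic_eq => [|j]; first by rewrite deg_dclass dE.
  by have := sum_sqr_eq0 sq (j := j) isT; rewrite mD; lia.
by split=> //; rewrite eD.
Qed.
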